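(* Let $H\in C^2(\mathbb{R}^d)$ be uniformly convex, let $F(p):=\sqrt{D^2H(p)}$, and let $C\in(0,\infty]$. (a) Suppose $u\in \mathrm{BUC}(\mathbb{R}^d\times[0,\infty))$ is a viscosity solution of $u_t=H(Du)$ in $\mathbb{R}^d\times(0,\infty)$ and $$-F(Du(\cdot,0))\,D^2u(\cdot,0)\,F(Du(\cdot,0))\le C\,I\quad\text{in }\mathbb{R}^d$$ in the viscosity sense. Then, for all $t>0$, in the viscosity sense, $$-F(Du(\cdot,t))\,D^2u(\cdot,t)\,F(Du(\cdot,t))\le \frac{C}{1+Ct}\,I\quad\text{in }\mathbb{R}^d.$$ (b) Suppose $u\in \mathrm{BUC}(\mathbb{R}^d\times[0,\infty))$ is a viscosity solution of $u_t=-H(Du)$ in $\mathbb{R}^d\times(0,\infty)$ and $$-F(Du(\cdot,0))\,D^2u(\cdot,0)\,F(Du(\cdot,0))\ge -C\,I\quad\text{in }\mathbb{R}^d$$ in the viscosity sense. Then, for all $t>0$, in the viscosity sense, $$-F(Du(\cdot,t))\,D^2u(\cdot,t)\,F(Du(\cdot,t))\ge -\frac{C}{1+Ct}\,I\quad\text{in }\mathbb{R}^d.$$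
   Context: $\mathrm{BUC}(X)$ is the set of bounded uniformly continuous real functions on $X$. $I$ is the $d\times d$ identity matrix, and matrix inequalities are in the sense of symmetric matrices. ''$H\in C^2(\mathbb{R}^d)$ is uniformly convex'' means that there exist $\Theta,\theta>0$ such that $\theta I\le D^2H(p)\le\Theta I$ for all $p\in\mathbb{R}^d$. $F(p)=\sqrt{D^2H(p)}$ is the positive definite symmetric square root. Solutions of $u_t=\pm H(Du)$ are Crandall-Lions viscosity solutions. For a continuous $v:\mathbb{R}^d\to\mathbb{R}$ and a constant $K$, the inequality $-F(Dv)D^2vF(Dv)\le K I$ (resp. $\ge -KI$) holds in the viscosity sense if, for every smooth $\phi$ and every maximum (resp. minimum) point $x_0$ of $v-\phi$, $-F(D\phi(x_0))D^2\phi(x_0)F(D\phi(x_0))\le K I$ (resp. $\ge -KI$). When $C=\infty$, no assumption is made on $u(\cdot,0)$ (the hypothesis is void), and $\frac{C}{1+Ct}$ is understood as $\frac1t$. *)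

(* Defs.v *)
From HB Require Import structures.
From mathcomp Require Import all_boot all_order all_algebra.
From mathcomp Require Import all_classical all_reals all_analysis.
Set Implicit Arguments.
Unset Strict Implicit.
Unset Printing Implicit Defensive.
Import Order.TTheory GRing.Theory Num.Theory.
Import numFieldNormedType.Exports.
Local Open Scope classical_set_scope.
Local Open Scope ring_scope.

(* Loewner order; it is only used between symmetric matrices. *)
Definition mxle (R : realType) (n : nat) (A B : 'M[R]_n) : Prop :=
  forall v : 'rV[R]_n, (v *m A *m v^T) 0 0 <= (v *m B *m v^T) 0 0.

(* The (unique) positive definite symmetric square root of A; the default
   value 0 is taken only when A is not symmetric positive definite. *)
Definition sqrtmx (R : realType) (n : nat) (A : 'M[R]_n) : 'M[R]_n :=
  xget 0 [set B : 'M[R]_n | [/\ B^T = B,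
    (forall v : 'rV[R]_n, v != 0 -> 0 < (v *m B *m v^T) 0 0) & B *m B = A]].

(* f is of class C^k on the open set O.  Directional derivatives along every
   vector are used, so that the definition applies both to R^d and to the
   product R^d * R; in finite dimension the partial derivatives suffice. *)
Fixpoint Ck (R : realType) (V : normedModType R) (O : set V) (k : nat)
    (f : V -> R) : Prop :=
  if k is k'.+1 then
    (forall x, O x -> differentiable f x) /\
    (forall v : V, Ck O k' (fun x => 'D_v f x))
  else forall x, O x -> {for x, continuous f}.

Definition grad (R : realType) (d : nat) (f : 'rV[R]_d -> R) (x : 'rV[R]_d) :
  'rV[R]_d := \row_i 'D_(delta_mx 0 i) f x.

Definition hess (R : realType) (d : nat) (f : 'rV[R]_d -> R) (x : 'rV[R]_d) :
  'M[R]_d :=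
  \matrix_(i, j) 'D_(delta_mx 0 i) (fun y => 'D_(delta_mx 0 j) f y) x.

Definition smooth (R : realType) (d : nat) (f : 'rV[R]_d -> R) : Prop :=
  forall k, Ck setT k f.

Definition uniformly_convex (R : realType) (d : nat) (H : 'rV[R]_d -> R) :
    Prop :=
  exists Theta theta : R, [/\ 0 < Theta, 0 < theta &
    forall p, mxle theta%:M (hess H p) /\ mxle (hess H p) Theta%:M].

(* f restricted to X is bounded and uniformly continuous; the values of f
   outside X are irrelevant. *)
Definition BUC (R : realType) (V : normedModType R) (X : set V) (f : V -> R) :
    Prop :=
  [bounded f x | x in X] /\
  forall e : R, 0 < e -> exists2 r : R, 0 < r &
    forall x y, X x -> X y -> `|x - y| < r -> `|f x - f y| < e.

(* Crandall-Lions viscosity solution of u_t = G(Du) in R^d x (0, oo), with C^1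
   test functions and local extrema.  A point of space-time is z = (x, t). *)
Definition viscosity_solution (R : realType) (d : nat) (G : 'rV[R]_d -> R)
    (u : 'rV[R]_d * R -> R) : Prop :=
  forall (phi : 'rV[R]_d * R -> R) (x : 'rV[R]_d) (t : R), 0 < t ->
    Ck [set z : 'rV[R]_d * R | 0 < z.2] 1 phi ->
    ((\forall z \near (x, t), u z - phi z <= u (x, t) - phi (x, t)) ->
       derive1 (fun s => phi (x, s)) t <= G (grad (fun y => phi (y, t)) x)) /\
    ((\forall z \near (x, t), u (x, t) - phi (x, t) <= u z - phi z) ->
       G (grad (fun y => phi (y, t)) x) <= derive1 (fun s => phi (x, s)) t).

(* - F(Dv) D^2 v F(Dv) <= K I in the viscosity sense; test functions are
   C^oo and the maxima are global. *)
Definition visc_le (R : realType) (d : nat) (F : 'rV[R]_d -> 'M[R]_d)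
    (v : 'rV[R]_d -> R) (K : R) : Prop :=
  forall (phi : 'rV[R]_d -> R) (x0 : 'rV[R]_d), smooth phi ->
    (forall x, v x - phi x <= v x0 - phi x0) ->
    mxle (- (F (grad phi x0) *m hess phi x0 *m F (grad phi x0))) K%:M.

(* - F(Dv) D^2 v F(Dv) >= K I in the viscosity sense. *)
Definition visc_ge (R : realType) (d : nat) (F : 'rV[R]_d -> 'M[R]_d)
    (v : 'rV[R]_d -> R) (K : R) : Prop :=
  forall (phi : 'rV[R]_d -> R) (x0 : 'rV[R]_d), smooth phi ->
    (forall x, v x0 - phi x0 <= v x - phi x) ->
    mxle K%:M (- (F (grad phi x0) *m hess phi x0 *m F (grad phi x0))).

(* C / (1 + C t), read as 1 / t when C = +oo; the value at -oo is not used. *)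
Definition rate (R : realType) (C : \bar R) (t : R) : R :=
  if C is c%:E then c / (1 + c * t) else t^-1.

(* Main.v *)
Require Import Defs.
From HB Require Import structures.
From mathcomp Require Import all_boot all_order all_algebra.
From mathcomp Require Import all_classical all_reals all_analysis.
From mathcomp Require Import ring lra.
Import Order.TTheory GRing.Theory Num.Theory.
Import numFieldNormedType.Exports.
Local Open Scope classical_set_scope.
Local Open Scope ring_scope.

(** For convex [H] the equation [u_t = H(Du)] is solved by the Hopf-Lax formula
[[
  u(x,t) = max_y ( u(y,0) - t L((y - x)/t) ),
]]
where [L] is the Legendre transform of [H].  Granting this, the curvature bound
is a computation at one point.  Let [phi] touch [u(.,t)] from above at [x0], let
[y0] attain the maximum at [x0], and let [p] be the point with
[DH(p) = (y0 - x0)/t].  For all [x] and [y] (lemma [max_point_dual]),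
[[
  u(y,0) - u(y0,0) <= phi(x) - phi(x0) + t L((y - x)/t) - t L((y0 - x0)/t).
]]
At [y = y0] the right-hand side is minimal at [x = x0], so [Dphi(x0) = DL(DH(p)) = p]
and [D^2 phi(x0) >= - M/t] with [M = D^2 L(DH(p)) = (D^2 H(p))^-1]: this is the
estimate with rate [1/t].  If the curvature of [u(.,0)] is controlled, let [x]
follow [y] along [x = x0 + a (y - y0)].  Then the right-hand side is a function of
[y] that touches [u(.,0)] from above at [y0], again with gradient [p], and the
hypothesis on [u(.,0)] reads
[[
  a^2 D^2 phi(x0) + ((1 - a)^2 / t) M >= - C M.
]]
The best choice, [a = 1 + C t], gives [D^2 phi(x0) >= - C/(1 + C t) M], which is
the claim because [M = F(p)^-2] (lemma [curvature_bound]).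

The gradient [p] is the same at time [0] and at time [t], so the square root
[F] is used at this single point.  Where [D^2 H(p)] had no positive definite
square root, [F(p)] would be [0] and the inequality to be proved trivial.

[L] is only of class [C^2] while test functions are smooth.  It is therefore
replaced by a polynomial that touches it from above at [DH(p)] (lemma
[legendre_sharp_upper]): the quadratic part carries a factor [kap > 1], which tends
to [1] at the end, and a quartic term takes care of large increments.

The Hopf-Lax formula consists of two comparisons of [u] with explicit functions,
so that no doubling of variables occurs.  For the lower bound ([hopf_lax_ge]),
[H(q) >= q.z - L(z)] makes [u] a supersolution of a transport equation with
constant velocity, and its minimum against a moving paraboloid is examined.  For
the upper bound ([hopf_lax_attained]), the kernel
[(y,s) |-> (t - s) L((y - x)/(t - s))] is a classical solution that degenerates only
at time [t], where it concentrates at [x].  In both comparisons the test functions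
are quadratic polynomials ([qtest]).

Part (b) is part (a) for [-u] and [p |-> H(-p)]. *)

Set Implicit Arguments.
Unset Strict Implicit.

(** * The Euclidean inner product *)
Section Dot.
Context {R : realType} {n : nat}.
Implicit Types (u v w : 'rV[R]_n) (a : R).

(** Row vectors carry the maximum norm; the convexity of [H] is measured by the
    Euclidean one, which enters only through its square. *)
Definition dot u v : R := (u *m v^T) 0 0.

Lemma dotE u v : dot u v = \sum_i u 0 i * v 0 i.
Proof. by rewrite /dot mxE; apply: eq_bigr => i _; rewrite mxE. Qed.

Lemma dotC u v : dot u v = dot v u.
Proof. by rewrite !dotE; apply: eq_bigr => i _; rewrite mulrC. Qed.

Lemma dotDl u v w : dot (u + v) w = dot u w + dot v w.
Proof. by rewrite /dot mulmxDl mxE. Qed.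

Lemma dotDr u v w : dot u (v + w) = dot u v + dot u w.
Proof. by rewrite dotC dotDl !(dotC u). Qed.

Lemma dotZl a u v : dot (a *: u) v = a * dot u v.
Proof. by rewrite /dot -scalemxAl mxE. Qed.

Lemma dotZr a u v : dot u (a *: v) = a * dot u v.
Proof. by rewrite dotC dotZl dotC. Qed.

Lemma dotNl u v : dot (- u) v = - dot u v.
Proof. by rewrite -scaleN1r dotZl mulN1r. Qed.

Lemma dotNr u v : dot u (- v) = - dot u v.
Proof. by rewrite dotC dotNl dotC. Qed.

Lemma dotBl u v w : dot (u - v) w = dot u w - dot v w.
Proof. by rewrite dotDl dotNl. Qed.

Lemma dotBr u v w : dot u (v - w) = dot u v - dot u w.
Proof. by rewrite dotDr dotNr. Qed.

Lemma dot0l v : dot 0 v = 0.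
Proof. by rewrite -(scale0r 0) dotZl mul0r. Qed.

Lemma dot0r v : dot v 0 = 0.
Proof. by rewrite dotC dot0l. Qed.

Definition dot_lin := (dotBl, dotBr, dotDl, dotDr, dotZl, dotZr, dotNl, dotNr,
  dot0l, dot0r).

Lemma dotvv_ge0 v : 0 <= dot v v.
Proof. by rewrite dotE sumr_ge0 // => i _; rewrite -expr2 sqr_ge0. Qed.

Lemma dot_eq0 v : dot v v <= 0 -> v = 0.
Proof.
move=> v0; have /eqP : dot v v == 0 by rewrite eq_le v0 dotvv_ge0.
rewrite dotE => /eqP; rewrite psumr_eq0 => [/allP h|i _]; last first.
  by rewrite -expr2 sqr_ge0.
apply/rowP => i; rewrite mxE; apply/eqP.
by have := h i (mem_index_enum _); rewrite mulf_eq0 orbb.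
Qed.

Lemma dot_young a u v : 0 < a ->
  dot u v <= a / 2 * dot u u + dot v v / (2 * a).
Proof.
move=> a0; have := dotvv_ge0 (a *: u - v); rewrite !dot_lin (dotC v u) => h.
rewrite -subr_ge0.
have -> : a / 2 * dot u u + dot v v / (2 * a) - dot u v =
  (a * (a * dot u u) - a * dot u v - (a * dot u v - dot v v)) / (2 * a).
  by field; rewrite gt_eqF.
by apply: divr_ge0; [lra | rewrite mulr_ge0 // ltW].
Qed.

Lemma dotD_le u v : dot (u + v) (u + v) <= 2 * dot u u + 2 * dot v v.
Proof. by have := dotvv_ge0 (u - v); rewrite !dot_lin; lra. Qed.

(** Euclidean balls thus give neighbourhoods and bounded sets for the maximum norm. *)
Lemma norm_le_dot v : `|v| ^+ 2 <= dot v v.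
Proof.
have [->|v0] := eqVneq v 0; first by rewrite normr0 expr0n /= dotvv_ge0.
have nv : `|v| = mx_norm v by [].
have [[i j] /= hij] := mx_norm_neq0 (negbT (introF eqP (fun e : mx_norm v = 0 =>
  elimN eqP v0 (mx_norm_eq0 e)))).
rewrite nv hij dotE (bigD1 j) //= (ord1 i) -expr2 real_normK ?num_real//.
by rewrite lerDl sumr_ge0 // => k _; rewrite -expr2 sqr_ge0.
Qed.

Lemma dot_continuous (T : topologicalType) (f g : T -> 'rV[R]_n) (x : T) :
  {for x, continuous f} -> {for x, continuous g} ->
  {for x, continuous (fun y => dot (f y) (g y))}.
Proof.
move=> cf cg; rewrite (_ : (fun y => _) = fun y => \sum_i f y 0 i * g y 0 i); last first.
  by apply/funext => y; rewrite dotE.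
have ch i : {for x, continuous (fun y => f y 0 i * g y 0 i)}.
  apply: cvgM.
  - exact: (cvg_comp _ _ cf (@coord_continuous _ _ _ 0 i (f x))).
  - exact: (cvg_comp _ _ cg (@coord_continuous _ _ _ 0 i (g x))).
elim: (index_enum _) => [|i s IH].
  rewrite (_ : (fun y => _) = cst 0); first exact: cvg_cst.
  by apply/funext => y; rewrite big_nil.
rewrite (_ : (fun y => _) = (fun y => f y 0 i * g y 0 i) \+
  (fun y => \sum_(j <- s) f y 0 j * g y 0 j)); first exact: (cvgD (ch i) IH).
by apply/funext => y; rewrite big_cons.
Qed.

Lemma dotl_continuous v : continuous (fun u => dot u v).
Proof.
move=> u; apply: (@dot_continuous _ id (fun=> v) u); first exact: cvg_id.
exact: cst_continuous.
Qed.

Lemma dotr_continuous v : continuous (dot v).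
Proof.
move=> u; apply: (@dot_continuous _ (fun=> v) id u); last exact: cvg_id.
exact: cst_continuous.
Qed.

Lemma compact_dot_ball (B : R) : compact [set v : 'rV[R]_n | dot v v <= B].
Proof.
apply: bounded_closed_compact.
  exists (1 + `|B|); split; first by rewrite num_real.
  move=> M hM v /= hv.
  have h : `|v| ^+ 2 <= `|B| by apply: le_trans (norm_le_dot v) (le_trans hv (ler_norm _)).
  rewrite leNgt; apply/negP => hMv.
  have := normr_ge0 B; nra.
rewrite (_ : [set _ | _] = (fun v => dot v v) @^-1` [set x | x <= B]) //.
apply: closed_comp; last exact: closed_le.
by move=> v _; apply: dot_continuous; apply: cvg_id.
Qed.

Lemma coercive_max (f : 'rV[R]_n -> R) c (B : R) : continuous f ->
  (forall v, B < dot (v - c) (v - c) -> f v <= f c) ->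
  exists v0, forall v, f v <= f v0.
Proof.
move=> fc fB; pose B' := 2 * `|B| + 2 * dot c c.
have hB v : B' < dot v v -> B < dot (v - c) (v - c).
  by have := dotD_le (v - c) c; have := ler_norm B; rewrite subrK /B'; lra.
have cB : dot c c <= B' by have := normr_ge0 B; have := dotvv_ge0 c; rewrite /B'; lra.
have [||v0 _ vmax] := @compact_EVT_max _ _ f _ _ (@compact_dot_ball B').
- by exists c.
- exact: continuous_subspaceT.
exists v0 => v; have [vB|vB] := leP (dot v v) B'; first by apply: vmax; rewrite inE.
by apply: le_trans (fB _ (hB _ vB)) (vmax _ _); rewrite inE.
Qed.

(** Every comparison starts from a positive maximum like this one: the boundary
    conditions at times [0] and [T] push it into the open strip, where a
    viscosity inequality is available. *)
Lemma coercive_strip_max (f : 'rV[R]_n * R -> R) c (B T : R) z1 :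
  continuous f ->
  (forall y s, 0 <= s <= T -> B < dot (y - c) (y - c) -> f (y, s) <= 0) ->
  (forall y, f (y, 0) <= 0) -> (forall y, f (y, T) <= 0) ->
  0 <= z1.2 <= T -> 0 < f z1 ->
  exists2 z0, 0 < z0.2 < T & forall z, 0 <= z.2 <= T -> f z <= f z0.
Proof.
move=> fc fB f0 fT z1T fz1; pose B' := 2 * `|B| + 2 * dot c c.
have hB v : B' < dot v v -> B < dot (v - c) (v - c).
  by have := dotD_le (v - c) c; have := ler_norm B; rewrite subrK /B'; lra.
have cK := compact_setX (@compact_dot_ball B') (@segment_compact _ 0 T).
have z1B : dot z1.1 z1.1 <= B'.
  rewrite leNgt; apply/negP => /hB hz.
  by have := fB _ _ z1T hz; rewrite -surjective_pairing; lra.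
have [||z0 z0K zmax] := @compact_EVT_max _ _ f _ _ cK.
- by exists z1; split; [exact: z1B | rewrite /= in_itv].
- exact: continuous_subspaceT.
move: z0K; rewrite inE => -[_]; rewrite /= in_itv /= => /andP[z00 z0T].
have fz0 : 0 < f z0.
  by apply: lt_le_trans fz1 (zmax _ _); rewrite inE; split=> //=; rewrite in_itv.
exists z0 => [|z zT].
  rewrite !lt_neqAle z00 z0T !andbT; apply/andP; split; apply/eqP => e; move: fz0.
    by rewrite (surjective_pairing z0) -e ltNge f0.
  by rewrite (surjective_pairing z0) e ltNge fT.
have [zB|/hB zB] := leP (dot z.1 z.1) B'.
  by apply: zmax; rewrite inE; split=> //=; rewrite in_itv.
by apply: le_trans (ltW fz0); rewrite (surjective_pairing z); exact: fB.
Qed.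

End Dot.

(** * Functions of class C^k *)
Section CkClosure.
Context {R : realType} {V : normedModType R}.
Implicit Types (f g : V -> R) (k : nat).

Lemma Ck_continuous f k : Ck setT k f -> continuous f.
Proof.
case: k => [|k] /= h x; first exact: h.
by apply: differentiable_continuous; apply: h.1.
Qed.

Lemma Ck_pred f k : Ck setT k.+1 f -> Ck setT k f.
Proof.
elim: k f => [|k IH] f hf; first by move=> x _; exact: (Ck_continuous hf).
by split=> [|v]; [exact: hf.1 | apply/IH/hf.2].
Qed.

Lemma Ck_cst (a : R) k : Ck (setT : set V) k (fun=> a).
Proof.
elim: k a => [|k IH] a /=; first by move=> x _; exact: cvg_cst.
split=> [x _|v]; first exact: differentiable_cst.
have -> : (fun x : V => 'D_v (fun=> a) x) = fun=> (0 : R); last exact: IH.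
by apply/funext => x; exact: derive_cst.
Qed.

Lemma Ck_deriv1 f k v x : Ck setT k.+1 f -> derivable f x v.
Proof. by move=> hf; apply: diff_derivable; apply: hf.1. Qed.

Lemma Ck_add f g k : Ck setT k f -> Ck setT k g ->
  Ck setT k (fun x => f x + g x).
Proof.
elim: k f g => [|k IH] f g hf hg.
  by move=> x _; exact: (cvgD (hf x I) (hg x I)).
split=> [x _|v]; first exact: (differentiableD (hf.1 x I) (hg.1 x I)).
rewrite (_ : (fun x => _) = fun x => 'D_v f x + 'D_v g x).
  exact: IH (hf.2 v) (hg.2 v).
apply/funext => x; apply: (@deriveD _ _ _ f g); [exact: (Ck_deriv1 hf)|exact: (Ck_deriv1 hg)].
Qed.

Lemma Ck_mul f g k : Ck setT k f -> Ck setT k g ->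
  Ck setT k (fun x => f x * g x).
Proof.
elim: k f g => [|k IH] f g hf hg.
  by move=> x _; exact: (cvgM (hf x I) (hg x I)).
split=> [x _|v]; first exact: (differentiableM (hf.1 x I) (hg.1 x I)).
rewrite (_ : (fun x => _) = fun x => f x * 'D_v g x + g x * 'D_v f x).
  by apply: Ck_add; apply: IH; [exact: Ck_pred|exact: hg.2|exact: Ck_pred|exact: hf.2].
apply/funext => x; apply: (@deriveM _ _ f g); [exact: (Ck_deriv1 hf)|exact: (Ck_deriv1 hg)].
Qed.

Lemma Ck_sum (I : Type) (s : seq I) (F : I -> V -> R) k :
  (forall i, Ck setT k (F i)) -> Ck setT k (fun x => \sum_(i <- s) F i x).
Proof.
move=> hF; elim: s => [|i s IH].
  rewrite (_ : (fun x => _) = fun=> 0); first exact: Ck_cst.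
  by apply/funext => x; rewrite big_nil.
rewrite (_ : (fun x => _) = fun x => F i x + \sum_(j <- s) F j x).
  exact: Ck_add.
by apply/funext => x; rewrite big_cons.
Qed.

Lemma Ck_linear f k : linear f -> continuous f -> Ck setT k f.
Proof.
move=> lf cf; pose L : {linear V -> R} :=
  HB.pack f (GRing.isLinear.Build R V R *%R f lf).
case: k => [|k]; first by move=> x _; exact: cf.
have dL x : differentiable L x by apply: linear_differentiable.
split=> [x _|v]; first exact: dL.
rewrite (_ : (fun x => _) = fun=> f v); first exact: Ck_cst.
by apply/funext => x; rewrite (deriveE _ (dL x)) diff_lin.
Qed.

Lemma derive_affine f (c : V) (a : R) x v : differentiable f (c + a *: x) ->
  is_derive x v (fun y => f (c + a *: y)) (a * 'D_v f (c + a *: x)).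
Proof.
move=> df.
have da : is_diff x (fun y => c + a *: y) ( *:%R a).
  apply: is_diff_eq; exact: add0r.
have ea : differentiable (fun y => c + a *: y) x by apply: ex_diff.
have dfa : differentiable (f \o (fun y => c + a *: y)) x.
  exact: differentiable_comp.
apply: DeriveDef; first exact: diff_derivable.
rewrite deriveE // (@diff_comp _ _ _ _ (fun y => c + a *: y) f) //=.
by rewrite diff_val deriveE // linearZ.
Qed.

Lemma Ck_affine f (c : V) (a : R) k : Ck setT k f ->
  Ck setT k (fun x => f (c + a *: x)).
Proof.
elim: k f => [|k IH] f hf.
  move=> x _; apply: (@continuous_comp _ _ _ (fun y => c + a *: y) f); last exact: hf.
  by apply: cvgD; [exact: cvg_cst | apply: cvgZr; exact: cvg_id].
split=> [x _|v].
  apply: (@differentiable_comp _ _ _ _ (fun y => c + a *: y) f); last exact: hf.1.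
  by apply: differentiableD; [exact: differentiable_cst|exact: differentiableZ].
rewrite (_ : (fun x => _) = fun x => a * 'D_v f (c + a *: x)).
  by apply: Ck_mul; [exact: Ck_cst | exact: (IH _ (hf.2 v))].
apply/funext => x; have df := hf.1 (c + a *: x) I.
exact: (@derive_val _ _ _ _ _ _ _ (derive_affine v df)).
Qed.

Lemma sub_Ck (O : set V) f k : Ck setT k f -> Ck O k f.
Proof.
elim: k f => [|k IH] f hf; first by move=> x _; exact: hf.
by split=> [x _|v]; [exact: hf.1 | apply: IH; exact: hf.2].
Qed.

Lemma is_derive_line f (x v : V) (s : R) : differentiable f (x + s *: v) ->
  is_derive s 1 (fun r => f (x + r *: v)) ('D_v f (x + s *: v)).
Proof.
move=> df.
have e : (fun h : R => h^-1 *: (((fun r => f (x + r *: v)) \o shift s) (h *: 1) -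
    f (x + s *: v))) =
  (fun h => h^-1 *: ((f \o shift (x + s *: v)) (h *: v) - f (x + s *: v))).
  apply/funext => h /=; congr (_ *: (f _ - _)).
  by rewrite (mulr1 h : h *: (1 : R) = h) scalerDl addrCA.
apply: DeriveDef; first by rewrite /derivable e; exact: (@diff_derivable _ _ _ f).
by rewrite /derive e.
Qed.

(** Both sides are limits of the same difference quotients, so this holds for any
    [f]. *)
Lemma derive_line f (x v : V) : 'D_v f x = 'D_1 (fun r : R => f (x + r *: v)) 0.
Proof.
rewrite /derive.
have -> // : (fun h : R => h^-1 *: (((fun r => f (x + r *: v)) \o shift 0) (h *: 1) -
    f (x + (0 : R) *: v))) =
  (fun h => h^-1 *: ((f \o shift x) (h *: v) - f x)).
apply/funext => h /=; rewrite scale0r addr0; congr (_ *: (f _ - _)).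
all: by rewrite ?(mulr1 h : h *: (1 : R) = h) ?addr0 1?addrC.
Qed.

End CkClosure.

(** * Gradient, Hessian and second-order expansions *)
Section SecondOrder.
Context {R : realType} {d : nat}.
Implicit Types (f : 'rV[R]_d -> R) (x v w : 'rV[R]_d).

Lemma derive_grad f x v : differentiable f x -> 'D_v f x = dot v (grad f x).
Proof.
move=> df; rewrite deriveE // {1}(row_sum_delta v) linear_sum dotE.
by apply: eq_bigr => i _; rewrite linearZ mxE deriveE.
Qed.

Lemma Ck2_diff f x : Ck setT 2 f -> differentiable f x.
Proof. by move=> hf; exact: (hf.1 x I). Qed.

Lemma Ck2_diff1 f x v : Ck setT 2 f -> differentiable (fun y => 'D_v f y) x.
Proof. by move=> hf; exact: ((hf.2 v).1 x I). Qed.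

Lemma derive2_hess f x v w : Ck setT 2 f ->
  'D_w (fun y => 'D_v f y) x = dot (w *m hess f x) v.
Proof.
move=> hf; rewrite derive_grad; last exact: Ck2_diff1.
rewrite /dot -mulmxA; congr ((w *m _) 0 0); apply/colP => i.
rewrite !mxE.
have -> : (fun y => 'D_v f y) =
    \sum_(j < d) (v 0 j *: (fun y => 'D_(delta_mx 0 j) f y)).
  apply/funext => y; rewrite derive_grad ?dotE; last exact: Ck2_diff.
  by rewrite fct_sumE; apply: eq_bigr => j _; rewrite mxE.
rewrite derive_sum; last first.
  by move=> j; apply: derivableZ; apply: diff_derivable; exact: Ck2_diff1.
apply: eq_bigr => j _; rewrite deriveZ; last first.
  by apply: diff_derivable; exact: Ck2_diff1.
by rewrite !mxE mulrC.
Qed.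

(** [s |-> g1 s - m s] is nondecreasing, hence so is
    [s |-> g s - g1 0 s - m s^2 / 2]. *)
Lemma taylor2_1d_ge (g g1 g2 : R -> R) (m : R) :
  (forall s : R, is_derive s (1 : R) g (g1 s)) -> (forall s : R, is_derive s (1 : R) g1 (g2 s)) ->
  (forall s : R, 0 <= s <= 1 -> m <= g2 s) -> g 0 + g1 0 + m / 2 <= g 1.
Proof.
move=> hg hg1 hm.
have mono (h h1 : R -> R) (s : R) : (forall s : R, is_derive s (1 : R) h (h1 s)) ->
    (forall s : R, 0 <= s <= 1 -> 0 <= h1 s) -> 0 <= s <= 1 -> h 0 <= h s.
  move=> dh h1p /andP[s0 s1].
  have cont : {within `[0, 1], continuous h}.
    by apply: derivable_within_continuous => y _; exact: ex_derive.
  have der y : y \in `]0, 1[ -> derivable h y 1 by move=> _; exact: ex_derive.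
  apply: (ger0_derive1_ndecr der _ cont) => //.
  move=> y; rewrite in_itv /= => /andP[y0 y1]; rewrite derive1E derive_val.
  by apply: h1p; rewrite !ltW.
pose k1 s := g1 s - g1 0 - m * s.
pose k s := g s - g1 0 * s - m / 2 * s ^+ 2.
have dk1 (s : R) : is_derive s (1 : R) k1 (g2 s - m).
  have := hg1 s => ?; apply: is_derive_eq.
  by rewrite /GRing.scale /=; ring.
have dk (s : R) : is_derive s (1 : R) k (k1 s).
  have := hg s => ?; apply: is_derive_eq.
  by rewrite /k1 /GRing.scale /=; field.
have k1p s : 0 <= s <= 1 -> 0 <= k1 s.
  move=> hs; have := mono k1 _ s dk1 _ hs.
  rewrite {1}/k1 mulr0 subrr subr0; apply => r hr.
  by rewrite subr_ge0 hm.
have := mono k k1 1 dk k1p; rewrite lexx ler01 => /(_ isT).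
rewrite /k; lra.
Qed.

Lemma taylor2_ge f x v m : Ck setT 2 f ->
  (forall s : R, 0 <= s <= 1 -> m <= 'D_v (fun y => 'D_v f y) (x + s *: v)) ->
  f x + 'D_v f x + m / 2 <= f (x + v).
Proof.
move=> hf hm.
have := @taylor2_1d_ge _ _ _ m
  (fun s => is_derive_line (@Ck2_diff f (x + s *: v) hf))
  (fun s => is_derive_line (@Ck2_diff1 f (x + s *: v) v hf)) hm.
by rewrite scale0r addr0 scale1r.
Qed.

Lemma taylor2_le f x v m : Ck setT 2 f ->
  (forall s : R, 0 <= s <= 1 -> 'D_v (fun y => 'D_v f y) (x + s *: v) <= m) ->
  f (x + v) <= f x + 'D_v f x + m / 2.
Proof.
move=> hf hm.
have := @taylor2_1d_ge _ _ _ (- m)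
  (fun s => @is_deriveN _ _ _ _ _ _ _ (is_derive_line (@Ck2_diff f (x + s *: v) hf)))
  (fun s => @is_deriveN _ _ _ _ _ _ _ (is_derive_line (@Ck2_diff1 f (x + s *: v) v hf))).
move=> /(_ _)/wrap[s hs|]; first by rewrite lerN2 hm.
rewrite !opprfctE scale0r addr0 scale1r; lra.
Qed.

Lemma derive_scale f x v (a : R) : differentiable f x ->
  'D_(a *: v) f x = a * 'D_v f x.
Proof. by move=> df; rewrite !derive_grad // dotZl. Qed.

Lemma derive2_scale f x v (a : R) : Ck setT 2 f ->
  'D_(a *: v) (fun y => 'D_(a *: v) f y) x = a ^+ 2 * 'D_v (fun y => 'D_v f y) x.
Proof. by move=> hf; rewrite !derive2_hess // -scalemxAl !dot_lin expr2 mulrA. Qed.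

(** For the second order: a negative value of the second derivative persists along
    a short segment by continuity, and Taylor's formula then makes [f] drop below
    its minimum. *)
Lemma min_derive f x v : Ck setT 2 f -> (forall y, f x <= f y) ->
  'D_v f x = 0 /\ 0 <= 'D_v (fun y => 'D_v f y) x.
Proof.
move=> hf fmin.
have d0 : 'D_v f x = 0.
  have dl s := is_derive_line (@Ck2_diff f (x + s *: v) hf).
  have := @derive1_at_min _ (fun r => f (x + r *: v)) (-1) 1 0.
  move=> /(_ _ _ _ _)/wrap[||||h].
  - lra.
  - by move=> t _; apply: ex_derive.
  - by rewrite in_itv /=; lra.
  - by move=> t _; rewrite scale0r addr0.
  have := @derive_val _ _ _ _ _ _ _ h.
  by rewrite (@derive_val _ _ _ _ _ _ _ (dl 0)) scale0r addr0.
split=> //; rewrite leNgt; apply/negP => c0.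
set c := 'D_v _ x in c0.
have cc : {for 0, continuous (fun s : R => 'D_v (fun y => 'D_v f y) (x + s *: v))}.
  apply: (@continuous_comp _ _ _ (fun s : R => x + s *: v)
    (fun z => 'D_v (fun y => 'D_v f y) z)).
    by apply: cvgD; [exact: cvg_cst | exact: scalel_continuous].
  exact: ((hf.2 v).2 v _ I).
have ce : c = 'D_v (fun y => 'D_v f y) (x + (0 : R) *: v) by rewrite scale0r addr0.
have /cvgr_lt /(_ (c / 2)) : (fun s : R => 'D_v (fun y => 'D_v f y) (x + s *: v))
  @ (0 : R) --> c by rewrite ce; exact: cc.
move=> /(_ _)/wrap[|]; first by lra.
move=> /nbhs_ballP[r /= r0 hr].
have r2 : 0 < r / 2 by lra.
have r22 : 0 < (r / 2) ^+ 2 := exprn_gt0 2 r2.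
have := @taylor2_le f x ((r / 2) *: v) ((r / 2) ^+ 2 * (c / 2)) hf.
move=> /(_ _)/wrap[s hs|].
  rewrite (derive2_scale _ _ _ hf) scalerA; apply: ler_wpM2l (ltW r22) _ _ _.
  apply: ltW.
  apply: hr; rewrite /ball /= sub0r normrN ger0_norm; nra.
rewrite derive_scale ?d0 ?mulr0; last exact: Ck2_diff.
have := fmin (x + (r / 2) *: v).
have : (r / 2) ^+ 2 * (c / 2) < 0 by rewrite (pmulr_rlt0 _ r22); lra.
lra.
Qed.

End SecondOrder.

(** * The Legendre transform of a uniformly convex function *)
Section Legendre.
Context {R : realType} {d : nat}.
(* [g] is the gradient of [H]; the two quadratic bounds express that the Hessian lies
   between [th] and [Th]. *)
Variables (H : 'rV[R]_d -> R) (g : 'rV[R]_d -> 'rV[R]_d) (th Th : R).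
Hypothesis th0 : 0 < th.
Hypothesis Th0 : 0 < Th.
Hypothesis Hlb : forall p q,
  H p + dot (q - p) (g p) + th / 2 * dot (q - p) (q - p) <= H q.
Hypothesis Hub : forall p q,
  H q <= H p + dot (q - p) (g p) + Th / 2 * dot (q - p) (q - p).
Hypothesis Hcont : continuous H.
Implicit Types (p q z : 'rV[R]_d).

Definition legendre z : R := sup (range (fun p => dot p z - H p)).

(** Strong convexity bounds [q.z - H q] by a quadratic in [q - p], which Young's
    inequality maximises. *)
Lemma fenchel_young_sup p z q :
  dot q z - H q <=
    dot p z - H p + dot (z - g p) (z - g p) / (2 * th).
Proof.
have := Hlb p q; have := dot_young (q - p) (z - g p) th0.
rewrite !dot_lin => h1 h2; lra.
Qed.

Lemma legendre_has_sup z : has_sup (range (fun p => dot p z - H p)).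
Proof.
split; first by exists (dot 0 z - H 0), 0.
exists (dot 0 z - H 0 + dot (z - g 0) (z - g 0) / (2 * th)) => _ [q _ <-].
exact: fenchel_young_sup.
Qed.

Lemma legendre_ge p z : dot p z - H p <= legendre z.
Proof. by apply: ub_le_sup; [exact: (legendre_has_sup z).2 | exists p]. Qed.

(** Together with [legendre_ge], this says that [L] lies between its tangent plane
    of slope [p] at [g p] and that plane plus a paraboloid: [L] is [C^(1,1)]. *)
Lemma legendre_le p z :
  legendre z <= dot p z - H p + dot (z - g p) (z - g p) / (2 * th).
Proof.
apply: ge_sup; first exact: (legendre_has_sup z).1.
by move=> _ [q _ <-]; exact: fenchel_young_sup.
Qed.

Lemma legendre_grad p : legendre (g p) = dot p (g p) - H p.
Proof.
apply/eqP; rewrite eq_le legendre_ge andbT; apply: le_trans (legendre_le p _) _.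
by rewrite subrr dot0l mul0r addr0.
Qed.

(** [z] is the slope of [H] at the maximum of [q |-> q.z - H q], which exists by
    coercivity. *)
Lemma grad_surj z : exists p, g p = z.
Proof.
pose f q := dot q z - H q.
pose B := dot (g 0 - z) (g 0 - z) / (th / 2) ^+ 2.
have th2 : 0 < th / 2 by rewrite divr_gt0.
have fc : continuous f.
  by move=> q; exact: (continuousB (@dotl_continuous _ _ z q) (@Hcont q)).
have [q|p pmax] := @coercive_max _ _ f 0 B fc.
  rewrite subr0 => qB; have := Hlb 0 q; rewrite /f !subr0 dot0l.
  have := @dot_young _ _ (th / 2) q (z - g 0) th2.
  rewrite !dot_lin (dotC z) => h1 h2.
  have : dot (g 0 - z) (g 0 - z) / (2 * (th / 2)) <= th / 4 * dot q q.
    have -> : dot (g 0 - z) (g 0 - z) / (2 * (th / 2)) = th / 4 * B.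
      by rewrite /B; field; rewrite gt_eqF.
    by rewrite ler_pM2l ?ltW //; lra.
  rewrite !dot_lin (dotC z) => h3; lra.
exists p; apply/eqP; rewrite -subr_eq0; apply/eqP/dot_eq0.
set w := g p - z.
(* A step of length 1/Th along -w would increase the maximised function. *)
have := pmax (p - Th^-1 *: w); have := Hub p (p - Th^-1 *: w).
rewrite /f.
have -> : p - Th^-1 *: w - p = - (Th^-1 *: w) by rewrite addrAC subrr add0r.
have ew : dot w w = dot w (g p) - dot w z by rewrite /w dotBr.
move: ew; clearbody w; rewrite !dot_lin; set a := dot w w; set b := dot w (g p).
set c := dot w z => ew h1 h2.
have : Th^-1 * a <= Th / 2 * (Th^-1 * (Th^-1 * a)) by rewrite {1}ew; lra.
have -> : Th / 2 * (Th^-1 * (Th^-1 * a)) = Th^-1 * a / 2 by field; rewrite gt_eqF.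
move=> h; have : Th^-1 * a <= 0 by lra.
by rewrite pmulr_rle0 // invr_gt0.
Qed.

(** Evaluate [q.z - H q] at [q = (z - g 0)/Th], the maximum for the quadratic upper
    bound of [H]. *)
Lemma legendre_coercive : exists2 b : R, 0 <= b &
  forall z, dot z z / (4 * Th) - b <= legendre z.
Proof.
exists (dot (g 0) (g 0) / (2 * Th) + `|H 0|).
  by rewrite addr_ge0 // divr_ge0 ?dotvv_ge0 // mulr_ge0 // ltW.
move=> z; apply: le_trans (legendre_ge (Th^-1 *: (z - g 0)) z).
have := Hub 0 (Th^-1 *: (z - g 0)); have := ler_norm (H 0).
have := dotvv_ge0 (z - 2 *: g 0).
have e : Th / 2 * dot (Th^-1 *: (z - g 0)) (Th^-1 *: (z - g 0)) =
  Th^-1 * (dot (z - g 0) (z - g 0) / 2).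
  by rewrite dotZl dotZr; field; rewrite gt_eqF.
rewrite !subr0 e !dot_lin (dotC (g 0) z).
set a := dot z z; set b := dot z (g 0); set c := dot _ _ => h0 h1 h2.
have -> : a / (4 * Th) - (c / (2 * Th) + `|H 0|) =
  Th^-1 * (a / 4 - c / 2) - `|H 0| by field; rewrite gt_eqF.
have i0 : 0 < Th^-1 by rewrite invr_gt0.
have : 0 <= Th^-1 * ((a - 4 * b + 4 * c) / 4) by rewrite mulr_ge0 ?(ltW i0)//; lra.
lra.
Qed.

Lemma legendre_continuous : continuous legendre.
Proof.
move=> z; have [p pz] := grad_surj z.
have Lz : legendre z = dot p z - H p by rewrite -pz legendre_grad.
pose lo y := dot p y - H p.
pose up y := lo y + dot (y - z) (y - z) / (2 * th).
have clo : {for z, continuous lo}.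
  exact: (continuousB (@dotr_continuous _ _ p z) (@cst_continuous _ _ (H p) z)).
have csub : {for z, continuous (fun y : 'rV[R]_d => y - z)}.
  apply: (@continuousB _ _ _ id (cst z)); [exact: cvg_id | exact: cst_continuous].
have cup : {for z, continuous up}.
  apply: (continuousD clo); apply: continuousM; last exact: cst_continuous.
  exact: (dot_continuous csub csub).
have bounds : \forall y \near nbhs z, lo y <= legendre y <= up y.
  apply: (@nearW _ (nbhs z)) => y; rewrite legendre_ge /=.
  by have := legendre_le p y; rewrite pz.
have Lup : legendre z = up z by rewrite /up Lz subrr dot0l mul0r addr0.
apply: (squeeze_cvgr bounds); first by rewrite Lz; exact: clo.
by rewrite Lup; exact: cup.
Qed.

End Legendre.

(** * Quadratic test functions in space-time *)
Section ContinuityAlgebra.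
Context {R : realType} {T : topologicalType}.
Implicit Types f g : T -> R.

Lemma continuous_add f g : continuous f -> continuous g ->
  continuous (fun x => f x + g x).
Proof. by move=> cf cg x; exact: (continuousD (@cf x) (@cg x)). Qed.

Lemma continuous_sub f g : continuous f -> continuous g ->
  continuous (fun x => f x - g x).
Proof. by move=> cf cg x; exact: (continuousB (@cf x) (@cg x)). Qed.

Lemma continuous_mul f g : continuous f -> continuous g ->
  continuous (fun x => f x * g x).
Proof. by move=> cf cg x; exact: (continuousM (@cf x) (@cg x)). Qed.

Lemma continuous_maxr f g : continuous f -> continuous g ->
  continuous (fun x => Num.max (f x) (g x)).
Proof. by move=> cf cg x; exact: (continuous_max (@cf x) (@cg x)). Qed.

Lemma comp_continuous (U W : topologicalType) (f : T -> U) (g : U -> W) :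
  continuous f -> continuous g -> continuous (fun x => g (f x)).
Proof. by move=> cf cg x; exact: (continuous_comp (@cf x) (@cg (f x))). Qed.

Lemma continuous_dot n (f g : T -> 'rV[R]_n) : continuous f -> continuous g ->
  continuous (fun x => dot (f x) (g x)).
Proof. by move=> cf cg x; exact: (dot_continuous (@cf x) (@cg x)). Qed.

Lemma continuous_vadd (V : normedModType R) (f g : T -> V) : continuous f ->
  continuous g -> continuous (fun x => f x + g x).
Proof. by move=> cf cg x; exact: (continuousD (@cf x) (@cg x)). Qed.

Lemma continuous_vscale (V : normedModType R) (k : T -> R) (f : T -> V) :
  continuous k -> continuous f -> continuous (fun x => k x *: f x).
Proof. by move=> ck cf x; exact: (continuousZ (@ck x) (@cf x)). Qed.

End ContinuityAlgebra.

Lemma continuous_fst (T U : topologicalType) : continuous (@fst T U).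
Proof. by move=> z; exact: cvg_fst. Qed.

Lemma continuous_snd (T U : topologicalType) : continuous (@snd T U).
Proof. by move=> z; exact: cvg_snd. Qed.

Lemma continuous_pair (T U V : topologicalType) (f : T -> U) (g : T -> V) :
  continuous f -> continuous g -> continuous (fun x => (f x, g x)).
Proof. by move=> cf cg x; exact: (cvg_pair (@cf x) (@cg x)). Qed.

Section QuadraticTest.
Context {R : realType} {d : nat}.
Implicit Types (p b x : 'rV[R]_d) (a A N t : R) (z : 'rV[R]_d * R).

(** The term with coefficient [A] vanishes, together with its gradient, on the line of
    velocity [-b] through the origin: it penalises the distance to a characteristic
    without changing the slope of the test function. *)
Definition qtest p b a A N z : R := dot p z.1 + a * z.2
  + A * dot (z.1 + z.2 *: b) (z.1 + z.2 *: b) + N * z.2 ^+ 2.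

Lemma qtest_Ck p b a A N k : Ck setT k (qtest p b a A N).
Proof.
have lin2 : Ck setT k (fun z : 'rV[R]_d * R => z.2).
  by apply: Ck_linear => //; exact: continuous_snd.
have lin1 (q : 'rV[R]_d) : Ck setT k (fun z : 'rV[R]_d * R => dot q z.1).
  apply: Ck_linear => [c y z /=|]; first by rewrite dotDr dotZr.
  apply: (@continuous_dot _ _ _ (fun=> q)); first exact: cst_continuous.
  exact: continuous_fst.
have lini i : Ck setT k (fun z : 'rV[R]_d * R => (z.1 + z.2 *: b) 0 i).
  rewrite (_ : (fun _ => _) = fun z => dot (delta_mx 0 i) z.1 + z.2 * b 0 i).
    by apply: (Ck_add (lin1 _)); apply: (Ck_mul lin2); exact: Ck_cst.
  apply/funext => z; rewrite !mxE dotE (bigD1 i) //= big1 => [|j /negPf ji].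
    by rewrite mxE !eqxx mul1r addr0.
  by rewrite mxE ji andbF mul0r.
rewrite /qtest; apply: Ck_add; last first.
  by apply: Ck_mul; [exact: Ck_cst|exact: (Ck_mul lin2 lin2)].
apply: Ck_add.
  by apply: (Ck_add (lin1 _)); apply: (Ck_mul _ lin2); exact: Ck_cst.
apply: Ck_mul; first exact: Ck_cst.
rewrite (_ : (fun _ => _) = fun z => \sum_i (z.1 + z.2 *: b) 0 i * (z.1 + z.2 *: b) 0 i).
  by apply: Ck_sum => i; exact: Ck_mul.
by apply/funext => z; rewrite dotE.
Qed.

Lemma derive_poly2 (a b : R) :
  is_derive (0 : R) (1 : R) (fun r : R => a * r + b * r ^+ 2) a.
Proof. by apply: is_derive_eq; rewrite /GRing.scale /=; ring. Qed.

Lemma qtest_grad p b a A N x t :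
  grad (fun y => qtest p b a A N ((y, t) - (x, t))) x = p.
Proof.
apply/rowP => i; rewrite mxE derive_line.
rewrite (_ : (fun _ => _) = fun r : R => dot p (delta_mx 0 i) * r +
  A * dot (delta_mx 0 i) (delta_mx 0 i) * r ^+ 2).
  rewrite (@derive_val _ _ _ _ _ _ _ (derive_poly2 _ _)).
  rewrite dotC dotE (bigD1 i) //= big1 => [|j /negPf ji].
    by rewrite mxE !eqxx mul1r addr0.
  by rewrite mxE ji andbF mul0r.
apply/funext => r; rewrite /qtest /=.
rewrite (addrAC x) subrr add0r subrr scale0r addr0 !dot_lin; ring.
Qed.

Lemma qtest_derive1 p b a A N x t :
  derive1 (fun s => qtest p b a A N ((x, s) - (x, t))) t = a.
Proof.
rewrite derive1E derive_line.
rewrite (_ : (fun _ => _) = fun r : R => a * r + (A * dot b b + N) * r ^+ 2).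
  exact: (@derive_val _ _ _ _ _ _ _ (derive_poly2 _ _)).
apply/funext => r; rewrite /qtest /=.
have -> : t + r *: (1 : R) - t = r by rewrite (mulr1 r : r *: (1 : R) = r) addrAC subrr add0r.
by rewrite subrr add0r !dot_lin; ring.
Qed.

(** At the contact point the test function has spatial gradient [p] and time
    derivative [a], so the viscosity inequalities compare [a] with [G p]. *)
Lemma visc_qtest (G : 'rV[R]_d -> R) u p b a A N x t :
  viscosity_solution G u -> 0 < t ->
  ((\forall z \near (x, t), u z - qtest p b a A N (z - (x, t)) <= u (x, t)) ->
    a <= G p) /\
  ((\forall z \near (x, t), u (x, t) <= u z - qtest p b a A N (z - (x, t))) ->
    G p <= a).
Proof.
move=> vu t0; pose phi z := qtest p b a A N (z - (x, t)).
have phiC : Ck [set z : 'rV[R]_d * R | 0 < z.2] 1 phi.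
  apply: sub_Ck; have := @Ck_affine _ _ _ (- (x, t)) 1 1 (@qtest_Ck p b a A N 1).
  by congr Ck; apply/funext => z; rewrite scale1r addrC.
have phi0 : phi (x, t) = 0.
  by rewrite /phi subrr /qtest /= scale0r addr0 !dot_lin; ring.
have [sub sup] := vu phi x t t0 phiC.
move: sub sup; rewrite phi0 subr0 /phi qtest_grad qtest_derive1 => sub sup.
by split; [exact: sub | exact: sup].
Qed.

End QuadraticTest.

(** * The Hopf-Lax formula *)
Section HopfLax.
Context {R : realType} {d : nat}.
Variables (H : 'rV[R]_d -> R) (g : 'rV[R]_d -> 'rV[R]_d) (th Th : R).
Hypothesis th0 : 0 < th.
Hypothesis Th0 : 0 < Th.
Hypothesis Hlb : forall p q,
  H p + dot (q - p) (g p) + th / 2 * dot (q - p) (q - p) <= H q.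
Hypothesis Hub : forall p q,
  H q <= H p + dot (q - p) (g p) + Th / 2 * dot (q - p) (q - p).
Hypothesis Hcont : continuous H.
Variables (u : 'rV[R]_d * R -> R) (M : R).
Hypothesis ucont : continuous u.
Hypothesis ubd : forall z, `|u z| <= M.
Hypothesis usub : forall (p b : 'rV[R]_d) (a A N : R) (x : 'rV[R]_d) (t : R),
  0 < t ->
  (\forall z \near (x, t), u z - qtest p b a A N (z - (x, t)) <= u (x, t)) ->
  a <= H p.
Hypothesis usup : forall (p b : 'rV[R]_d) (a A N : R) (x : 'rV[R]_d) (t : R),
  0 < t ->
  (\forall z \near (x, t), u (x, t) <= u z - qtest p b a A N (z - (x, t))) ->
  H p <= a.

Let L := legendre H.
(* A C^1 penalty in time is the square of [ramp]: it stays zero up to a given time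
   and then keeps maxima away from the end of the time interval. *)
Let ramp (r : R) : R := Num.max r 0.

Lemma ramp_ge0 (r : R) : 0 <= ramp r.
Proof. by rewrite /ramp le_max lexx orbT. Qed.

(** The square of [ramp] is semiconcave, so it can be replaced by a quadratic
    polynomial at the contact point. *)
Lemma ramp_sqr (r s : R) :
  ramp r ^+ 2 <= ramp s ^+ 2 + 2 * ramp s * (r - s) + (r - s) ^+ 2.
Proof.
rewrite /ramp; case: (leP r 0) => hr; case: (leP s 0) => hs.
- by rewrite expr0n /= mulr0 mul0r !add0r sqr_ge0.
- rewrite expr0n /= -subr_ge0 subr0.
  by rewrite (_ : _ + _ = r ^+ 2) ?sqr_ge0 //; ring.
- by rewrite expr0n /= mulr0 mul0r !add0r ler_sqr ?nnegrE; lra.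
- by rewrite -subr_ge0 (_ : _ - _ = 0) //; ring.
Qed.

Lemma near_strip (T : R) (z0 : 'rV[R]_d * R) : 0 < z0.2 < T ->
  \forall z \near z0, 0 <= z.2 <= T.
Proof.
move=> zT; have h : \forall s \near z0.2, 0 <= s <= T.
  have /near_in_itvoo : z0.2 \in `]0, T[ by rewrite in_itv.
  by apply: filterS => s; rewrite in_itv /= => /andP[s0 sT]; rewrite !ltW.
exact: (@continuous_snd _ _ z0 _ h).
Qed.

(** Since [H q >= q.z - L z], [u] is a supersolution of the transport equation
    [w_t = z.Dw - L z].  If the inequality failed, [u] plus a paraboloid centred at
    [x + (t - s) z], plus [(L z + del) s], would have an interior minimum; there
    the transport part of the time derivative cancels [q.z], for [q] the gradient of
    the test function, and [del > 0] gives a contradiction. *)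
Lemma hopf_lax_ge x y t : 0 < t ->
  u (y, 0) <= u (x, t) + t * L (t^-1 *: (y - x)).
Proof.
move=> t0; set z := t^-1 *: (y - x); set l := L z.
have tz : t *: z = y - x by rewrite /z scalerA mulfV ?gt_eqF // scale1r.
rewrite leNgt; apply/negP => lt_u; pose m := u (y, 0) - u (x, t) - t * l.
have m0 : 0 < m by rewrite /m; lra.
have M0 : 0 <= M := le_trans (normr_ge0 _) (ubd 0).
have ule z' : u z' <= M := le_trans (ler_norm _) (ubd z').
have uge z' : - M <= u z' by have := ubd z'; rewrite ler_norml => /andP[].
have [r r0 hr] : exists2 r : R, 0 < r &
    forall y', dot (y' - y) (y' - y) < r -> u (y, 0) - m / 2 < u (y', 0).
  have cu0 : continuous (fun y' : 'rV[R]_d => u (y', 0)).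
    apply: (@comp_continuous _ _ _ (fun y' : 'rV[R]_d => (y', 0 : R)) u) => //.
    apply: continuous_pair; last exact: cst_continuous.
    by move=> y'; exact: cvg_id.
  have cuy : {for y, continuous (fun y' => u (y', 0))} := @cu0 y.
  have : u (y, 0) - m / 2 < u (y, 0) by lra.
  move=> /(cvgr_gt _ cuy) /nbhs_ballP[r /= r0 hr].
  exists (r ^+ 2); first exact: exprn_gt0.
  move=> y' hy'; apply: hr; rewrite -ball_normE /= distrC.
  have := norm_le_dot (y' - y); have := normr_ge0 (y' - y); nra.
(* The paraboloid is steep enough for its minimum at time 0 to sit near [y]. *)
pose q := 2 * (M + 1) / r.
have q0 : 0 < q by rewrite divr_gt0 // mulr_gt0 //; lra.
have qr : q * r = 2 * (M + 1) by rewrite /q divfK // gt_eqF.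
have u0ge y' : u (y, 0) - m / 2 <= u (y', 0) + q * dot (y' - y) (y' - y).
  have [h|h] := ltP (dot (y' - y) (y' - y)) r.
    by have := hr _ h; have := mulr_ge0 (ltW q0) (dotvv_ge0 (y' - y)); lra.
  have : q * r <= q * dot (y' - y) (y' - y) by rewrite ler_pM2l.
  have := ule (y, 0); have := uge (y', 0); lra.
pose del := m / (4 * t).
have del0 : 0 < del by rewrite divr_gt0 // mulr_gt0.
have delt : del * t = m / 4 by rewrite /del; field; rewrite gt_eqF.
(* Large enough to dominate everything else at time [t + 1]. *)
pose N := 2 * M + `|l| * (t + 1).
pose T := t + 1.
pose e (z' : 'rV[R]_d * R) := z'.1 - x - (t - z'.2) *: z.
pose f (z' : 'rV[R]_d * R) := u (y, 0) - m / 2 - (u z' + (l + del) * z'.2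
  + q * dot (e z') (e z') + N * ramp (z'.2 - t) ^+ 2).
have lT s : 0 <= s <= T -> - (`|l| * T) <= l * s.
  move=> /andP[s0 sT]; have := ler_norm (- l); have := normr_ge0 l.
  rewrite normrN; nra.
have ecenter y' s : 0 <= s <= T ->
    dot (y' - x) (y' - x) <= 2 * dot (e (y', s)) (e (y', s)) + 2 * T ^+ 2 * dot z z.
  move=> /andP[s0 sT]; pose r' := t - s.
  have -> : y' - x = e (y', s) + r' *: z by rewrite /e subrK.
  apply: le_trans (dotD_le _ _) _; rewrite dotZl dotZr lerD2l -mulrA ler_pM2l //.
  rewrite (mulrA r') -expr2 ler_wpM2r ?dotvv_ge0 //.
  have T0 : 0 < T by rewrite /T; lra.
  have : `|r'| <= T by rewrite ler_norml /r' /T; rewrite /T in sT; lra.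
  by rewrite -[r' ^+ 2]real_normK ?num_real // ler_sqr ?nnegrE // ltW.
have fcont : continuous f.
  have c2 : continuous (fun z' : 'rV[R]_d * R => z'.2) by exact: continuous_snd.
  have ce : continuous e.
    apply: continuous_vadd; first apply: continuous_vadd.
    - exact: continuous_fst.
    - exact: cst_continuous.
    - rewrite (_ : (fun _ => _) = fun z' : 'rV[R]_d * R => (z'.2 - t) *: z).
        apply: continuous_vscale; last exact: cst_continuous.
        by apply: continuous_sub => //; exact: cst_continuous.
      by apply/funext => z'; rewrite -scaleNr opprB.
  apply: continuous_sub; first exact: cst_continuous.
  have cm (c : R) h : continuous h -> continuous (fun z' : 'rV[R]_d * R => c * h z').
    by apply: continuous_mul; exact: cst_continuous.
  apply: continuous_add; last first.
    apply: cm; have cr : continuous (fun z' : 'rV[R]_d * R => ramp (z'.2 - t)).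
      apply: continuous_maxr; last exact: cst_continuous.
      by apply: continuous_sub => //; exact: cst_continuous.
    exact: (continuous_mul cr cr).
  apply: continuous_add; last by apply: cm; exact: continuous_dot.
  by apply: continuous_add => //; exact: cm.
have T0 : 0 < T by rewrite /T; lra.
have N0 : 0 <= N by rewrite addr_ge0 ?mulr_ge0 //; lra.
have pen_ge0 s : 0 <= N * ramp s ^+ 2 by rewrite mulr_ge0 ?sqr_ge0.
have [|||||z0 z0T zmax] := @coercive_strip_max _ _ f x
   (2 * (2 * M + `|l| * T) / q + 2 * T ^+ 2 * dot z z) T (x, t) fcont.
- move=> y' s sT hB; have := ecenter y' s sT; have := lT s sT.
  have /andP[s0 _] := sT; have := mulr_ge0 (ltW del0) s0.
  have := pen_ge0 (s - t); have := ule (y, 0); have := uge (y', s).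
  rewrite /f /=; set E := dot _ (e (y', s)) => h1 h2 h3 h4 h5 h6.
  have : (2 * M + `|l| * T) / q < E by lra.
  rewrite ltr_pdivrMr // mulrC; lra.
- move=> y'; have := u0ge y'; have := pen_ge0 (0 - t).
  rewrite /f /e /= subr0 tz (_ : y' - x - (y - x) = y' - y); last first.
    by rewrite opprB addrA subrK.
  lra.
- move=> y'; have := lT T; rewrite lexx ltW // => /(_ isT) h1.
  have := mulr_ge0 (ltW q0) (dotvv_ge0 (e (y', T))); have := mulr_ge0 (ltW del0) (ltW T0).
  have := ule (y, 0); have := uge (y', T); rewrite /f /=.
  have -> : ramp (T - t) = 1.
    by rewrite /T (addrC t) addrK /ramp; apply/max_idPl.
  rewrite expr1n mulr1 /N -/T; lra.
- by rewrite /= /T; lra.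
- rewrite /f /e /= !subrr scale0r subr0 dot0l /ramp maxxx expr0n /= !mulr0 !addr0.
  by move: m0 delt; rewrite /m; lra.
case: z0 z0T zmax => y' s /= sT zmax.
pose E := e (y', s).
have s0 : 0 < s by case/andP: sT.
have near_le : \forall z' \near (y', s), u (y', s) <=
    u z' - qtest (- (2 * q) *: E) z
      (- (l + del) - 2 * q * dot E z - 2 * N * ramp (s - t)) (- q) (- N) (z' - (y', s)).
  apply: filterS (@near_strip T (y', s) sT) => -[y2 s2] /= hs2.
  have := zmax (y2, s2) hs2; rewrite /f /qtest /=.
  have -> : e (y2, s2) = E + (y2 - y' + (s2 - s) *: z).
    by apply/rowP => i; rewrite /E /e /= !mxE; ring.
  rewrite -/E; set D := y2 - y' + _.
  have -> : y2 - y' = D - (s2 - s) *: z by rewrite /D addrK.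
  have := ramp_sqr (s2 - t) (s - t).
  have -> : s2 - t - (s - t) = s2 - s by ring.
  move=> /(ler_wpM2l N0); clearbody E D; rewrite !dot_lin (dotC D E); lra.
have := usup s0 near_le; have := legendre_ge th0 Hlb (- (2 * q) *: E) z.
have : 0 <= 2 * N * ramp (s - t).
  exact: (mulr_ge0 (mulr_ge0 _ N0) (ramp_ge0 _)).
rewrite -/L -/l dotZl; lra.
Qed.

(** Let [B] be the maximum of [u(y,0) - t L((y - x)/t)] over [y].  The function
    [B + (t - s) L((y - x)/(t - s))] is above [u] at time [0] and solves the
    equation for [s < t], so it stays above [u]; at [(x, t - eps)] it equals
    [B + eps L(0)], and [eps -> 0] gives the claim.  To be a test function at a
    contact point, the kernel is replaced by the quadratic polynomial that
    [legendre_le] puts above it. *)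
Lemma hopf_lax_attained x t : 0 < t ->
  exists y, u (x, t) + t * L (t^-1 *: (y - x)) <= u (y, 0).
Proof.
move=> t0; have Lcont : continuous L := legendre_continuous th0 Th0 Hlb Hub Hcont.
have [b b0 Lcoer] := legendre_coercive th0 Th0 Hlb Hub.
have M0 : 0 <= M := le_trans (normr_ge0 _) (ubd 0).
have ule z' : u z' <= M := le_trans (ler_norm _) (ubd z').
have uge z' : - M <= u z' by have := ubd z'; rewrite ler_norml => /andP[].
pose a := (4 * Th * t)^-1.
have a0 : 0 < a by rewrite invr_gt0 !mulr_gt0.
have kcoer tau h : 0 < tau <= t -> a * dot h h - b * t <= tau * L (tau^-1 *: h).
  move=> /andP[tau0 taut]; apply: le_trans (ler_wpM2l (ltW tau0) (Lcoer _)).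
  rewrite dotZl dotZr mulrBr lerB //; last by rewrite mulrC ler_wpM2l.
  rewrite [leRHS](_ : _ = (4 * Th * tau)^-1 * dot h h); last first.
    by field; rewrite !gt_eqF.
  rewrite ler_wpM2r ?dotvv_ge0 // /a lef_pV2 ?posrE ?mulr_gt0 //.
  by rewrite ler_pM2l // mulr_gt0.
pose F y := u (y, 0) - t * L (t^-1 *: (y - x)).
have cx : continuous (fun y : 'rV[R]_d => y - x).
  apply: continuous_vadd; last exact: cst_continuous.
  by move=> y; exact: cvg_id.
have Fcont : continuous F.
  apply: continuous_sub.
    apply: (@comp_continuous _ _ _ (fun y' : 'rV[R]_d => (y', 0 : R)) u) => //.
    by apply: continuous_pair; [move=> y; exact: cvg_id | exact: cst_continuous].
  apply: continuous_mul; first exact: cst_continuous.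
  apply: (@comp_continuous _ _ _ (fun y : 'rV[R]_d => t^-1 *: (y - x)) L) => //.
  by apply: continuous_vscale => //; exact: cst_continuous.
have [y0 y0max] : exists y0, forall y, F y <= F y0.
  apply: (@coercive_max _ _ F x (a^-1 * (2 * M + b * t + t * L 0)) Fcont) => y.
  rewrite ltr_pdivrMl // => hy.
  have := kcoer t (y - x); rewrite lexx t0 => /(_ isT).
  have := ule (y, 0); have := uge (x, 0).
  rewrite /F subrr scaler0; lra.
exists y0; rewrite -lerBrDr -/(F y0) leNgt; apply/negP => ltF.
set B := F y0 in y0max ltF.
have step eps : 0 < eps < t -> u (x, t - eps) <= B + eps * L 0.
  move=> /andP[eps0 epst]; rewrite leNgt; apply/negP => gap.
  pose s1 := t - eps; pose T := t - eps / 2; pose m := u (x, s1) - B - eps * L 0.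
  have m0 : 0 < m by rewrite /m /s1; lra.
  have s10 : 0 < s1 by rewrite /s1; lra.
  pose del := m / (2 * s1).
  have del0 : 0 < del by rewrite divr_gt0 // mulr_gt0.
  have dels : del * s1 = m / 2 by rewrite /del; field; rewrite gt_eqF.
  pose K := M + `|B| + b * t.
  have K0 : 0 <= K by rewrite !addr_ge0 ?mulr_ge0 // ltW.
  pose N := 4 * K / eps ^+ 2.
  have N0 : 0 <= N by rewrite divr_ge0 ?sqr_ge0 // mulr_ge0.
  have pen_ge0 s : 0 <= N * ramp s ^+ 2 by rewrite mulr_ge0 ?sqr_ge0.
  (* The truncation makes the kernel continuous for all times; it is inactive on
     the strip [0, T]. *)
  pose tau s := Num.max (t - s) (eps / 2).
  have tauE s : s <= T -> tau s = t - s.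
    by move=> sT; apply/max_idPl; rewrite /T in sT; lra.
  have tau_gt0 s : 0 < tau s by rewrite /tau lt_max; apply/orP; right; lra.
  pose k (z : 'rV[R]_d * R) := tau z.2 * L ((tau z.2)^-1 *: (z.1 - x)).
  pose f (z : 'rV[R]_d * R) :=
    u z - B - k z - del * z.2 - N * ramp (z.2 - s1) ^+ 2.
  have c2 : continuous (fun z' : 'rV[R]_d * R => z'.2) by exact: continuous_snd.
  have cst2 (c : R) : continuous (fun z' : 'rV[R]_d * R => c).
    by exact: cst_continuous.
  have ctau : continuous (fun z' : 'rV[R]_d * R => tau z'.2).
    by apply: continuous_maxr => //; exact: continuous_sub.
  have ck : continuous k.
    apply: continuous_mul => //.
    apply: (@comp_continuous _ _ _
      (fun z : 'rV[R]_d * R => (tau z.2)^-1 *: (z.1 - x)) L) => //.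
    apply: continuous_vscale.
      move=> z; apply: (@continuousV _ _ (fun z => tau z.2) z); last exact: ctau.
      by rewrite gt_eqF.
    by apply: (@comp_continuous _ _ _ fst (fun y : 'rV[R]_d => y - x)) => //; exact: continuous_fst.
  have fcont : continuous f.
    have cr : continuous (fun z' : 'rV[R]_d * R => ramp (z'.2 - s1)).
      by apply: continuous_maxr => //; exact: continuous_sub.
    apply: continuous_sub; last by apply: continuous_mul => //; exact: (continuous_mul cr cr).
    apply: continuous_sub; last exact: continuous_mul.
    by apply: continuous_sub => //; exact: continuous_sub.
  have kge y s : 0 <= s <= T -> a * dot (y - x) (y - x) - b * t <= k (y, s).
    by move=> /andP[s0 sT]; apply: kcoer; rewrite tau_gt0 tauE //=; lra.
  have [|||||z0 z0T zmax] := @coercive_strip_max _ _ f x (a^-1 * K) T (x, s1) fcont.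
  - move=> y s sT; rewrite ltr_pdivrMl // => hB.
    have /andP[s0 _] := sT; have := mulr_ge0 (ltW del0) s0.
    have := kge y s sT; have := pen_ge0 (s - s1).
    have := ule (y, s); have := ler_norm (- B).
    rewrite /f /= normrN; rewrite /K in hB; lra.
  - move=> y; have := y0max y; have := pen_ge0 (0 - s1).
    rewrite /f /F /k /= tauE ?subr0 ?mulr0; last by rewrite /T; lra.
    lra.
  - move=> y; have T0 : 0 <= T by rewrite /T; lra.
    have := kge y T; rewrite lexx T0 => /(_ isT).
    have := mulr_ge0 (ltW del0) T0; have := ule (y, T).
    have := ler_norm (- B); have := mulr_ge0 (ltW a0) (dotvv_ge0 (y - x)).
    have -> : f (y, T) = u (y, T) - B - k (y, T) - del * T - K.
      rewrite /f /= (_ : ramp (T - s1) = eps / 2); last first.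
        by rewrite (_ : T - s1 = eps / 2) /T /s1; [apply/max_idPl; lra | field].
      by rewrite /N; congr (_ - _); field; rewrite gt_eqF.
    by rewrite normrN /K; lra.
  - by apply/andP; split; rewrite /= /T /s1; lra.
  - rewrite /f /k /= subrr scaler0 /ramp subrr maxxx expr0n /= mulr0 subr0 dels.
    rewrite tauE; last by rewrite /T /s1; lra.
    by rewrite {2}/s1 subKr; move: m0; rewrite /m; lra.
  case: z0 z0T zmax => y s /= sT zmax.
  have /andP[s0 sT'] := sT; have tauEs := tauE s (ltW sT').
  have [p pz] := grad_surj th0 Th0 Hlb Hub Hcont ((tau s)^-1 *: (y - x)).
  set z := _ *: _ in pz; have taus0 := tau_gt0 s.
  have tz : y - x = tau s *: z by rewrite /z scalerA mulfV ?gt_eqF // scale1r.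
  have kz : k (y, s) = dot p (y - x) - tau s * H p.
    rewrite /k /= -/z -pz /L (legendre_grad th0 Hlb) pz tz !dotZr; ring.
  have near_ge : \forall z' \near (y, s), u z' - qtest p z
      (H p + del + 2 * N * ramp (s - s1)) ((th * eps)^-1) N (z' - (y, s)) <= u (y, s).
    apply: filterS (@near_strip T (y, s) sT) => -[y2 s2] /= hs2.
    have := zmax (y2, s2) hs2; rewrite /f /qtest /= kz.
    set D := y2 - y + _.
    have tau2 := tau_gt0 s2; have /andP[_ s2T] := hs2; have tauE2 := tauE _ s2T.
    have tau2z : y2 - x = tau s2 *: z + D.
      rewrite tauE2 /D addrCA -scalerDl (_ : t - s2 + (s2 - s) = tau s).
        by rewrite -tz addrA subrK.
      by rewrite tauEs; ring.
    have k2 : k (y2, s2) <= dot p (y2 - x) - tau s2 * H p + (th * eps)^-1 * dot D D.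
      rewrite /k /=; apply: le_trans (ler_wpM2l (ltW tau2) (legendre_le th0 Hlb p _)) _.
      have -> : (tau s2)^-1 *: (y2 - x) - g p = (tau s2)^-1 *: D.
        by rewrite tau2z pz scalerDr scalerA mulVf ?gt_eqF // scale1r addrAC subrr add0r.
      rewrite !dotZr dotZl.
      have -> : tau s2 * ((tau s2)^-1 * dot p (y2 - x) - H p
          + (tau s2)^-1 * ((tau s2)^-1 * dot D D) / (2 * th)) =
        dot p (y2 - x) - tau s2 * H p + (2 * th * tau s2)^-1 * dot D D.
        by field; rewrite !gt_eqF.
      rewrite lerD2l ler_wpM2r ?dotvv_ge0 // lef_pV2 ?posrE ?mulr_gt0 //.
      by rewrite -mulrA mulrCA ler_pM2l // tauE2; rewrite /T in s2T; lra.
    have := ramp_sqr (s2 - s1) (s - s1).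
    have -> : s2 - s1 - (s - s1) = s2 - s by ring.
    move=> /(ler_wpM2l N0); move: k2.
    have -> : y2 - y = y2 - x - (y - x) by rewrite opprB addrA subrK.
    rewrite tauE2 tauEs !(dotBr p); clearbody D; lra.
  have : 0 <= 2 * N * ramp (s - s1).
    exact: (mulr_ge0 (mulr_ge0 _ N0) (ramp_ge0 _)).
  by have := usub s0 near_ge; lra.
have chi : continuous (fun eps : R => u (x, t - eps) - eps * L 0).
  apply: continuous_sub; last first.
    by apply: continuous_mul; [move=> y; exact: cvg_id | exact: cst_continuous].
  apply: (@comp_continuous _ _ _ (fun eps : R => (x, t - eps)) u) => //.
  apply: continuous_pair; first exact: cst_continuous.
  by apply: continuous_sub; [exact: cst_continuous | move=> y; exact: cvg_id].
have : B < u (x, t - 0) - 0 * L 0 by rewrite subr0 mul0r subr0.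
move=> /(cvgr_gt _ (chi 0)) /nbhs_ballP[r /= r0 hr].
pose eps := Num.min r t / 2.
have m0 : 0 < Num.min r t by rewrite lt_min r0.
have mr : Num.min r t <= r by rewrite ge_min lexx.
have mt : Num.min r t <= t by rewrite ge_min lexx orbT.
have := step eps; rewrite /eps; have -> : 0 < Num.min r t / 2 < t by lra.
move=> /(_ isT); have := hr eps; rewrite /ball /= sub0r normrN ger0_norm; last by rewrite /eps; lra.
move=> /(_ _)/wrap[|]; rewrite /eps; lra.
Qed.

End HopfLax.

(** * Sharp local bound on the Legendre transform *)
Section UniformConvexity.
Context {R : realType} {d : nat}.
Variables (H : 'rV[R]_d -> R) (th Th : R).
Hypothesis HC2 : Ck setT 2 H.
Hypothesis th0 : 0 < th.
Hypothesis Hth : forall p, mxle th%:M (hess H p).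
Hypothesis HTh : forall p, mxle (hess H p) Th%:M.

Lemma mxle_scalar_dot (c : R) (v : 'rV[R]_d) :
  (v *m c%:M *m v^T) 0 0 = c * dot v v.
Proof. by rewrite mul_mx_scalar -scalemxAl mxE. Qed.

Lemma hess_ge p v : th * dot v v <= dot (v *m hess H p) v.
Proof. by rewrite -mxle_scalar_dot; exact: Hth. Qed.

Lemma quad_lower p q :
  H p + dot (q - p) (grad H p) + th / 2 * dot (q - p) (q - p) <= H q.
Proof.
have := @taylor2_ge _ _ H p (q - p) (th * dot (q - p) (q - p)) HC2.
move=> /(_ _)/wrap[s _|]; first by rewrite derive2_hess // hess_ge.
rewrite addrCA subrr addr0 derive_grad; last exact: Ck2_diff.
by rewrite mulrAC.
Qed.

Lemma quad_upper p q :
  H q <= H p + dot (q - p) (grad H p) + Th / 2 * dot (q - p) (q - p).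
Proof.
have := @taylor2_le _ _ H p (q - p) (Th * dot (q - p) (q - p)) HC2.
move=> /(_ _)/wrap[s _|].
  by rewrite derive2_hess // -mxle_scalar_dot; exact: HTh.
rewrite addrCA subrr addr0 derive_grad; last exact: Ck2_diff.
by rewrite mulrAC.
Qed.

(** Continuity of the entries controls the quadratic form uniformly over all
    directions [v]. *)
Lemma hess_near p (eta : R) : 0 < eta -> exists2 rho : R, 0 < rho &
  forall q v, dot (q - p) (q - p) < rho ->
    dot (v *m hess H p) v - eta * dot v v <= dot (v *m hess H q) v.
Proof.
move=> eta0; (* [d.+1] rather than [d], so that the quotient is meaningful for [d = 0]. *)
pose eta' := eta / d.+1%:R.
have eta'0 : 0 < eta' by rewrite divr_gt0.
have cont i j : \forall q \near p, `|hess H p i j - hess H q i j| < eta'.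
  have ch : {for p, continuous (fun q => hess H q i j)}.
    rewrite (_ : (fun q => _) = fun q => 'D_(delta_mx 0 i) (fun y => 'D_(delta_mx 0 j) H y) q).
      exact: ((HC2.2 _).2 _ p I).
    by apply/funext => q; rewrite mxE.
  by move/cvgr_dist_lt: ch => /(_ _ eta'0).
have := @filter_forall _ ('I_d * 'I_d)%type
  (fun ij q => `|hess H p ij.1 ij.2 - hess H q ij.1 ij.2| < eta') (nbhs p) (nbhs_filter p)
  (fun ij => cont ij.1 ij.2).
move=> /nbhs_ballP[r /= r0 hr]; exists (r ^+ 2); first exact: exprn_gt0.
move=> q v hq.
have {}hr i j : `|hess H p i j - hess H q i j| < eta'.
  apply: (hr q _ (i, j)); rewrite -ball_normE /= distrC.
  by have := norm_le_dot (q - p); have := normr_ge0 (q - p); nra.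
move: (hess H p) (hess H q) hr => A B hr.
have -> : dot (v *m B) v = dot (v *m A) v - dot (v *m (A - B)) v.
  by rewrite mulmxBr dotBl subKr.
rewrite lerD2l lerN2 dotE.
have bnd i : (v *m (A - B)) 0 i * v 0 i <=
    \sum_j (eta' / 2 * (v 0 j ^+ 2 + v 0 i ^+ 2)).
  rewrite mxE mulr_suml; apply: ler_sum => j _; rewrite !mxE -mulrA.
  have hh := ltW (hr j i). 
  set h := _ - _ in hh *; apply: le_trans (ler_norm _) _; rewrite !normrM.
  rewrite -[v 0 j ^+ 2]real_normK ?num_real // -[v 0 i ^+ 2]real_normK ?num_real //.
  rewrite mulrCA.
  apply: le_trans (ler_wpM2r (mulr_ge0 (normr_ge0 (v 0 j)) (normr_ge0 (v 0 i))) hh) _.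
  rewrite -mulrA ler_pM2l //; have := sqr_ge0 (`|v 0 j| - `|v 0 i|).
  rewrite sqrrB; lra.
apply: le_trans (ler_sum _ (fun i _ => bnd i)) _.
under eq_bigr do rewrite -mulr_sumr big_split /= sumr_const card_ord.
rewrite -mulr_sumr big_split /= sumr_const card_ord sumrMnl.
have -> : \sum_(i < d) v 0 i ^+ 2 = dot v v.
  by rewrite dotE; apply: eq_bigr => i _; rewrite expr2.
have -> : eta = eta' * (d%:R + 1) by rewrite natr1 divfK // pnatr_eq0.
rewrite -(mulr_natl (dot v v)); have := mulr_ge0 (ltW eta'0) (dotvv_ge0 v); lra.
Qed.

(** Near [p], [H] grows at least like [kap^-1 / 2 |r B|^2] beyond its tangent, and
    the conjugate of this quadratic form is [kap / 2 |w B^-1|^2].  Points [p + r]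
    with [r] bounded away from [0] compete in the supremum only when [w] is bounded
    away from [0] as well, and are covered by the quartic term. *)
Lemma legendre_sharp_upper p (B : 'M[R]_d) (kap : R) : 1 < kap ->
  B^T = B -> B *m B = hess H p -> B \in unitmx ->
  exists N : R, forall w, legendre H (grad H p + w) <=
    dot p (grad H p + w) - H p + kap / 2 * dot (w *m invmx B) (w *m invmx B)
    + N * dot w w ^+ 2.
Proof.
move=> kap1 BT BB Bu; pose G := invmx B.
have kap0 : 0 < kap by lra.
have eta0 : 0 < (1 - kap^-1) * th by rewrite mulr_gt0 // subr_gt0 invf_lt1.
have [rho rho0 hrho] := hess_near p eta0.
(* The constant makes the last estimate of the proof a perfect square. *)
exists (th ^+ 3 * rho)^-1 => w; apply: ge_sup; first by exists (dot 0 (grad H p + w) - H 0), 0.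
move=> _ [q _ <-]; pose r := q - p.
have -> : q = p + r by rewrite /r addrC subrK.
have qB0 : 0 <= kap / 2 * dot (w *m G) (w *m G).
  by rewrite mulr_ge0 ?dotvv_ge0 // divr_ge0 // ltW.
have hB v : dot (v *m hess H p) v = dot (v *m B) (v *m B).
  by rewrite /dot -BB trmx_mul BT !mulmxA.
have [rr|rr] := ltP (dot r r) rho.
  have := @taylor2_ge _ _ H p r (kap^-1 * dot (r *m B) (r *m B)) HC2.
  move=> /(_ _)/wrap[s /andP[s0 s1]|].
    rewrite derive2_hess //; apply: le_trans (hrho (p + s *: r) r _); last first.
      apply: le_lt_trans rr; rewrite addrC addKr dotZl dotZr mulrA -expr2.
      by rewrite ler_piMl ?dotvv_ge0 // expr_le1.
    rewrite hB; have := hess_ge p r; rewrite hB => h.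
    have : 0 <= (1 - kap^-1) * (dot (r *m B) (r *m B) - th * dot r r).
      by rewrite mulr_ge0 ?subr_ge0 // invf_le1 // ltW.
    lra.
  rewrite derive_grad; last exact: Ck2_diff.
  have yk : 0 < kap^-1 by rewrite invr_gt0.
  have := dot_young (r *m B) (w *m G) yk.
  have -> : dot (r *m B) (w *m G) = dot r w.
    have GT : G^T = G by rewrite /G trmx_inv BT.
    by rewrite /dot trmx_mul GT mulmxA mulmxK.
  have -> : dot (w *m G) (w *m G) / (2 * kap^-1) = kap / 2 * dot (w *m G) (w *m G).
    by field; rewrite gt_eqF.
  have : 0 <= (th ^+ 3 * rho)^-1 * dot w w ^+ 2.
    by rewrite mulr_ge0 ?sqr_ge0 // invr_ge0 mulr_ge0 ?exprn_ge0 // ltW.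
  rewrite !dot_lin -/G; lra.
have := quad_lower p (p + r); have -> : p + r - p = r by rewrite addrC addKr.
have th2 : 0 < th / 2 by rewrite divr_gt0.
have := dot_young r w th2.
have : 0 <= (th ^+ 3 * rho)^-1 * (th ^+ 2 * rho / 2 - dot w w) ^+ 2.
  by rewrite mulr_ge0 ?sqr_ge0 // invr_ge0 mulr_ge0 ?exprn_ge0 // ltW.
have -> : (th ^+ 3 * rho)^-1 * (th ^+ 2 * rho / 2 - dot w w) ^+ 2 =
  th * rho / 4 - dot w w / th + (th ^+ 3 * rho)^-1 * dot w w ^+ 2.
  by field; rewrite !gt_eqF.
have -> : dot w w / (2 * (th / 2)) = dot w w / th by field; rewrite gt_eqF.
have : th * rho <= th * dot r r by rewrite ler_pM2l.
rewrite !dot_lin -/G; lra.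
Qed.

End UniformConvexity.

(** * Polynomial test functions in space *)
Section QuarticTest.
Context {R : realType} {d : nat}.
Implicit Types (p e w x c : 'rV[R]_d) (G : 'M[R]_d) (A N a b : R).

Definition ptest p G A N e : R :=
  dot p e + A * dot (e *m G) (e *m G) + N * dot e e ^+ 2.

Lemma ptest_Ck p G A N k : Ck setT k (ptest p G A N).
Proof.
have lin (q : 'rV[R]_d) : Ck setT k (dot q).
  apply: Ck_linear; last exact: dotr_continuous.
  by move=> c y z /=; rewrite dotDr dotZr.
have sq (B : 'M[R]_d) : Ck setT k (fun e => dot (e *m B) (e *m B)).
  rewrite (_ : (fun _ => _) = fun e => \sum_i dot (col i B)^T e * dot (col i B)^T e).
    by apply: Ck_sum => i; exact: Ck_mul.
  apply/funext => e; rewrite dotE; apply: eq_bigr => i _.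
  have -> // : (e *m B) 0 i = dot (col i B)^T e.
  by rewrite dotC dotE mxE; apply: eq_bigr => j _; rewrite !mxE.
have sq1 : Ck setT k (fun e => dot e e).
  by rewrite (_ : (fun _ => _) = fun e => dot (e *m 1%:M) (e *m 1%:M)) //;
    apply/funext => e; rewrite mulmx1.
apply: Ck_add; first apply: Ck_add => //; apply: Ck_mul => //; try exact: Ck_cst.
exact: (Ck_mul sq1 sq1).
Qed.

Lemma derive_poly4 (c0 c1 c2 c3 c4 : R) :
  is_derive (0 : R) (1 : R)
    (fun r : R => c0 + c1 * r + c2 * r ^+ 2 + c3 * r ^+ 3 + c4 * r ^+ 4) c1.
Proof. by apply: is_derive_eq; rewrite /GRing.scale /=; ring. Qed.

(** Along the line spanned by [w], [ptest] is a polynomial of degree four in one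
    variable. *)
Lemma ptest_derive p G A N w :
  'D_w (ptest p G A N) 0 = dot p w /\
  'D_w (fun e => 'D_w (ptest p G A N) e) 0 = 2 * A * dot (w *m G) (w *m G).
Proof.
pose Q := dot (w *m G) (w *m G); pose W := dot w w ^+ 2.
have line (r : R) : ptest p G A N (r *: w) =
    dot p w * r + A * Q * r ^+ 2 + N * W * r ^+ 4.
  by rewrite /ptest -scalemxAl !dot_lin /Q /W; ring.
have D (h : R) : 'D_w (ptest p G A N) (h *: w) =
    dot p w + 2 * (A * Q) * h + 4 * (N * W) * h ^+ 3.
  rewrite derive_line; apply: (@derive_val _ _ _ _ _ _ _ _).
  rewrite (_ : (fun _ => _) = fun r : R =>
      (dot p w * h + A * Q * h ^+ 2 + N * W * h ^+ 4)
    + (dot p w + 2 * (A * Q) * h + 4 * (N * W) * h ^+ 3) * r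
    + (A * Q + 6 * (N * W) * h ^+ 2) * r ^+ 2
    + 4 * (N * W) * h * r ^+ 3 + N * W * r ^+ 4); first exact: derive_poly4.
  by apply/funext => r; rewrite -scalerDl line; ring.
split; first by rewrite -[in LHS](scale0r w) D; ring.
rewrite derive_line; apply: (@derive_val _ _ _ _ _ _ _ _).
rewrite (_ : (fun _ => _) = fun r : R => dot p w + 2 * A * Q * r + 0 * r ^+ 2
   + 4 * (N * W) * r ^+ 3 + 0 * r ^+ 4); first exact: derive_poly4.
by apply/funext => r; rewrite add0r D; ring.
Qed.

Lemma derive_test f c x a b p G A N w : Ck setT 2 f ->
  let psi := fun y => f (c + a *: y) + ptest p G A N (b *: (y - x)) in
  'D_w psi x = a * 'D_w f (c + a *: x) + b * dot p w /\
  'D_w (fun y => 'D_w psi y) x = a ^+ 2 * 'D_w (fun y => 'D_w f y) (c + a *: x)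
    + b ^+ 2 * (2 * A * dot (w *m G) (w *m G)).
Proof.
move=> hf psi; pose P := ptest p G A N; have PC : Ck setT 2 P := ptest_Ck p G A N 2.
have psiE : psi = fun y => f (c + a *: y) + P (- (b *: x) + b *: y).
  by apply/funext => y; rewrite /psi scalerBr [- _ + _]addrC.
have aff (h : 'rV[R]_d -> R) (e : 'rV[R]_d) (s : R) y : Ck setT 1 h ->
    is_derive y w (fun z => h (e + s *: z)) (s * 'D_w h (e + s *: y)).
  by move=> hh; apply: derive_affine; exact: hh.1.
have D1 y : is_derive y w psi
    (a * 'D_w f (c + a *: y) + b * 'D_w P (- (b *: x) + b *: y)).
  by rewrite psiE; apply: is_deriveD; apply: aff; exact: Ck_pred.
have D1E : (fun y => 'D_w psi y) =
    fun y => a * 'D_w f (c + a *: y) + b * 'D_w P (- (b *: x) + b *: y).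
  by apply/funext => y; exact: (@derive_val _ _ _ _ _ _ _ (D1 y)).
have D2 : is_derive x w (fun y => 'D_w psi y)
    (a * (a * 'D_w (fun y => 'D_w f y) (c + a *: x)) +
     b * (b * 'D_w (fun y => 'D_w P y) (- (b *: x) + b *: x))).
  rewrite D1E; apply: is_deriveD; apply: is_deriveZ; apply: aff.
    exact: (hf.2 w).
  exact: (PC.2 w).
have [P1 P2] := ptest_derive p G A N w.
rewrite (@derive_val _ _ _ _ _ _ _ (D1 x)) (@derive_val _ _ _ _ _ _ _ D2) addNr.
by rewrite P1 P2 !mulrA -!expr2.
Qed.

End QuarticTest.

(** * The curvature bound *)
Section QuadraticSolution.
Context {R : realType} {d : nat}.
Implicit Types (G : 'rV[R]_d -> R) (u : 'rV[R]_d * R -> R).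

(** What the comparisons use of a viscosity solution; unlike the definition with
    general test functions, it is visibly stable under reflection and under a
    change of [u] at negative times. *)
Definition quad_solution G u := forall (p b : 'rV[R]_d) (a A N : R)
    (x : 'rV[R]_d) (t : R), 0 < t ->
  ((\forall z \near (x, t), u z - qtest p b a A N (z - (x, t)) <= u (x, t)) ->
    a <= G p) /\
  ((\forall z \near (x, t), u (x, t) <= u z - qtest p b a A N (z - (x, t))) ->
    G p <= a).

Lemma quad_solution_opp G u : quad_solution (fun p => - G p) u ->
  quad_solution (fun p => G (- p)) (fun z => - u z).
Proof.
move=> hu p b a A N x t t0; have [sub sup] := hu (- p) b (- a) (- A) (- N) x t t0.
have qN z : qtest (- p) b (- a) (- A) (- N) z = - qtest p b a A N z.
  by rewrite /qtest dotNl; ring.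
split=> h; rewrite -[leLHS]opprK -[leRHS]opprK lerN2 ?opprK.
  by apply: sup; apply: filterS h => z; rewrite qN; lra.
by apply: sub; apply: filterS h => z; rewrite qN; lra.
Qed.

(** Extension to negative times, by the initial value, that turns continuity on the
    closed half-space into continuity everywhere. *)
Definition clamp u : 'rV[R]_d * R -> R := fun z => u (z.1, Num.max z.2 0).

Lemma clampE u x t : 0 <= t -> clamp u (x, t) = u (x, t).
Proof. by move=> t0; rewrite /clamp /=; have /max_idPl -> := t0. Qed.

Lemma quad_solution_clamp G u : quad_solution G u -> quad_solution G (clamp u).
Proof.
move=> hu p b a A N x t t0; have [sub sup] := hu p b a A N x t t0.
have near0 : \forall z \near (x, t), 0 <= z.2.
  have tz : 0 < (x, t).2 < t + 1 by rewrite /= t0; lra.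
  by apply: filterS (near_strip tz) => z /andP[].
rewrite (clampE _ _ (ltW t0)); split=> h.
  apply: sub; apply: filterS2 near0 h => -[y s] /= s0.
  by rewrite clampE.
apply: sup; apply: filterS2 near0 h => -[y s] /= s0.
by rewrite clampE.
Qed.

Lemma clamp_continuous u : BUC [set z : 'rV[R]_d * R | 0 <= z.2] u ->
  continuous (clamp u).
Proof.
move=> [_ uc] z; apply/cvgrPdist_lt => e e0.
have [r r0 hr] := uc e e0.
apply: filterS (nbhsx_ballx z r r0) => y; rewrite prod_norm_ball /= => hy.
have m0 (s : R) : 0 <= Num.max s 0 by rewrite le_max lexx orbT.
apply: hr; rewrite /= ?m0 //.
apply: le_lt_trans hy; rewrite !prod_normE /= ge_max !le_max lexx /=.
apply/orP; right; case: (leP z.2 0); case: (leP y.2 0) => h1 h2; rewrite ler_norml.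
- by rewrite subrr; have := normr_ge0 (z.2 - y.2); lra.
- by have := ler_norm (- (z.2 - y.2)); rewrite normrN; lra.
- by have := ler_norm (z.2 - y.2); lra.
- by have := ler_norm (z.2 - y.2); have := ler_norm (- (z.2 - y.2)); rewrite normrN; lra.
Qed.

Lemma clamp_bounded u : BUC [set z : 'rV[R]_d * R | 0 <= z.2] u ->
  exists M, forall z, `|clamp u z| <= M.
Proof.
move=> [[M [Mr hM]] _]; exists (M + 1) => z; apply: (hM (M + 1)); first by lra.
by rewrite /= le_max lexx orbT.
Qed.

Lemma BUC_opp (X : set ('rV[R]_d * R)) u : BUC X u -> BUC X (fun z => - u z).
Proof.
move=> [[M [Mr hM]] uc]; split.
  by exists M; split=> // M' /hM h x /h; rewrite /= normrN.
move=> e /uc[r r0 hr]; exists r => // x y Xx Xy /(hr _ _ Xx Xy).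
by rewrite -opprD normrN.
Qed.

End QuadraticSolution.

Section Curvature.
Context {R : realType} {d : nat}.
Variables (H : 'rV[R]_d -> R) (th Th : R).
Hypothesis HC2 : Ck setT 2 H.
Hypothesis th0 : 0 < th.
Hypothesis Th0 : 0 < Th.
Hypothesis Hth : forall p, mxle th%:M (hess H p).
Hypothesis HTh : forall p, mxle (hess H p) Th%:M.

Let Hlb := quad_lower HC2 Hth.
Let Hub := quad_upper HC2 HTh.
Let L := legendre H.

(** The Hopf-Lax formula, read as an equality at [(x0, y0)] and as an inequality at
    all other pairs [(x, y)]. *)
Lemma max_point_dual u t (phi : 'rV[R]_d -> R) x0 :
  BUC [set z : 'rV[R]_d * R | 0 <= z.2] u -> quad_solution H u -> 0 < t ->
  (forall x, u (x, t) - phi x <= u (x0, t) - phi x0) ->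
  exists y0 p, y0 - x0 = t *: grad H p /\ forall x y,
    u (y, 0) - u (y0, 0) <=
      phi x - phi x0 + t * (L (t^-1 *: (y - x)) - L (grad H p)).
Proof.
move=> hu vu t0 hmax; have cu := clamp_continuous hu; have [M bu] := clamp_bounded hu.
have vc := quad_solution_clamp vu.
have Hc : continuous H := Ck_continuous HC2.
have [y0] := hopf_lax_attained th0 Th0 Hlb Hub Hc cu bu
  (fun p b a A N x t t0 => (vc p b a A N x t t0).1) x0 t0.
have := @hopf_lax_ge _ _ H (grad H) th th0 Hlb (clamp u) M cu bu
  (fun p b a A N x t t0 => (vc p b a A N x t t0).2).
move=> ge att; have [p pz] := grad_surj th0 Th0 Hlb Hub Hc (t^-1 *: (y0 - x0)).
exists y0, p; split; first by rewrite pz scalerA mulfV ?gt_eqF // scale1r.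
move=> x y; have := ge x y t t0; move: att.
rewrite !(clampE _ _ (ltW t0)) !(clampE _ _ (lexx 0)) -pz.
by have := hmax x; rewrite /L; lra.
Qed.

(** Rescaling from [L] to the kernel [h |-> t L(h/t)]. *)
Lemma legendre_kernel_upper t p e (A N : R) (G : 'M[R]_d) : 0 < t ->
  (forall w, L (grad H p + w) <= dot p (grad H p + w) - H p
     + A * dot (w *m G) (w *m G) + N * dot w w ^+ 2) ->
  t * (L (grad H p + t^-1 *: e) - L (grad H p)) <=
    ptest p G (A / t) (N / t ^+ 3) e.
Proof.
move=> t0 hL; have := hL (t^-1 *: e).
have Lp : L (grad H p) = dot p (grad H p) - H p := legendre_grad th0 Hlb p.
rewrite Lp /ptest.
rewrite -scalemxAl !dot_lin => h.
have h2 : 0 <= t * (dot p (grad H p) + t^-1 * dot p e - H p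
  + A * (t^-1 * (t^-1 * dot (e *m G) (e *m G))) + N * (t^-1 * (t^-1 * dot e e)) ^+ 2
  - L (grad H p + t^-1 *: e)) by rewrite mulr_ge0 ?subr_ge0 // ltW.
rewrite -subr_ge0; apply: le_trans h2 _; rewrite le_eqVlt; apply/orP; left.
by apply/eqP; field; rewrite gt_eqF.
Qed.


(** With [y0] fixed, [phi] plus the kernel is minimal at [x0], and [DL(DH(p)) = p].
    A paraboloid above the kernel, with the same slope, takes its place. *)
Lemma max_point_grad t (phi : 'rV[R]_d -> R) x0 y0 p : 0 < t ->
  Ck setT 2 phi -> y0 - x0 = t *: grad H p ->
  (forall x, 0 <= phi x - phi x0 + t * (L (t^-1 *: (y0 - x)) - L (grad H p))) ->
  grad phi x0 = p.
Proof.
move=> t0 phiC e0 hphi.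
have psiC : Ck setT 2 (fun x => phi (0 + 1 *: x) +
    ptest p 1%:M ((2 * th)^-1 / t) (0 / t ^+ 3) ((-1) *: (x - x0))).
  apply: Ck_add; first exact: Ck_affine.
  rewrite (_ : (fun x => _) = fun x =>
    ptest p 1%:M ((2 * th)^-1 / t) (0 / t ^+ 3) (x0 + (-1) *: x)).
    by apply: (@Ck_affine _ _ (ptest _ _ _ _)); exact: ptest_Ck.
  by apply/funext => x; rewrite scalerBr !scaleN1r opprK addrC.
have upper w : L (grad H p + w) <= dot p (grad H p + w) - H p
     + (2 * th)^-1 * dot (w *m 1%:M) (w *m 1%:M) + 0 * dot w w ^+ 2.
  have := legendre_le th0 Hlb p (grad H p + w).
  by rewrite mulmx1 mul0r addr0 (addrC (grad H p)) addrK [_^-1 * _]mulrC.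
apply/eqP; rewrite -subr_eq0; apply/eqP/dot_eq0; set w := _ - p.
have [] := @min_derive _ _ _ x0 w psiC _.
  move=> x; rewrite !add0r !scale1r subrr scaler0.
  have := @legendre_kernel_upper t p ((-1) *: (x - x0)) _ _ 1%:M t0 upper.
  have := hphi x.
  have -> : t^-1 *: (y0 - x) = grad H p + t^-1 *: ((-1) *: (x - x0)).
    rewrite scaleN1r opprB -[y0](subrK x0) -addrA e0 scalerDr scalerA mulVf ?gt_eqF //.
    by rewrite scale1r.
  have -> : ptest p 1%:M ((2 * th)^-1 / t) (0 / t ^+ 3) 0 = 0.
    by rewrite /ptest mul0mx !dot0r; ring.
  lra.
have [-> _] := derive_test 0 x0 1 (-1) p 1%:M ((2 * th)^-1 / t) (0 / t ^+ 3) w phiC.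
rewrite add0r scale1r derive_grad; last exact: Ck2_diff.
by move=> h _; rewrite {2}/w dotBr (dotC w p); lra.
Qed.


(** This removes the factor [kap] left by [legendre_sharp_upper]. *)
Lemma ge_opp_mul_gt1 (X Y : R) : 0 <= Y ->
  (forall kap, 1 < kap -> - (kap * Y) <= X) -> - Y <= X.
Proof.
move=> Y0 h; rewrite leNgt; apply/negP => lt_X.
pose kap := 1 + (- Y - X) / (2 * (Y + 1)).
have k0 : 0 < (- Y - X) / (2 * (Y + 1)) by rewrite divr_gt0 //; lra.
have := h kap; rewrite /kap ltrDl => /(_ k0).
have : (- Y - X) / (2 * (Y + 1)) * Y <= (- Y - X) / 2.
  rewrite -mulrA ler_wpM2l //; first by lra.
  rewrite mulrC ler_pdivrMr; first by nra.
  by lra.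
lra.
Qed.

Lemma posdef_unitmx (B : 'M[R]_d) :
  (forall v : 'rV[R]_d, v != 0 -> 0 < (v *m B *m v^T) 0 0) -> B \in unitmx.
Proof.
move=> Bpos; rewrite -row_free_unit -kermx_eq0; apply/eqP/row_matrixP => i.
rewrite row0; apply/eqP; apply: contraT => /Bpos.
rewrite -row_mul mulmx_ker row0 mul0mx mxE ltxx //.
Qed.

(** With [P] the polynomial bound for the kernel, the function
    [y |-> phi(x0 + a (y - y0)) + P(b (y - y0))] is a test function for [u(.,0)] at
    [y0] if [a + b = 1], and its gradient is then [p].  The choice [a = 1 + C t]
    minimises [((1 - a)^2 / t + C) / a^2].  For [C = oo] the point [y0] stays fixed
    and [x |-> phi(x) + P(x0 - x)] is minimal at [x0]. *)
Lemma curvature_bound u t (C : \bar R) : (0 < C)%E ->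
  BUC [set z : 'rV[R]_d * R | 0 <= z.2] u -> quad_solution H u -> 0 < t ->
  (forall c : R, C = c%:E ->
    visc_le (fun p => sqrtmx (hess H p)) (fun x => u (x, 0)) c) ->
  visc_le (fun p => sqrtmx (hess H p)) (fun x => u (x, t)) (rate C t).
Proof.
move=> C0 hu vu t0 init phi x0 phis hmax; have phiC := phis 2%N.
have [y0 [p [e0 hphi]]] := max_point_dual hu vu t0 hmax.
have phi_ge x : 0 <= phi x - phi x0 + t * (L (t^-1 *: (y0 - x)) - L (grad H p)).
  by have := hphi x y0; rewrite subrr.
have gp := max_point_grad t0 phiC e0 phi_ge.
rewrite gp; have rate_ge0 : 0 <= rate C t.
  case: C C0 {init} => [c| |] //=; last by rewrite invr_ge0 ltW.
  rewrite lte_fin => c0; rewrite divr_ge0 ?(ltW c0) //.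
  by rewrite addr_ge0 // mulr_ge0 ?ltW.
(* If [D^2 H(p)] has no positive definite root, [F(p) = 0] and the bound is
   trivial. *)
rewrite /sqrtmx; case: xgetP => [B sB [BT Bpos BB]|_]; last first.
  move=> v.
  rewrite mul0mx mulmx0 oppr0 mulmx0 mul0mx mxE mxle_scalar_dot.
  by rewrite mulr_ge0 ?dotvv_ge0.
have Bu := posdef_unitmx Bpos; pose G := invmx B.
pose D2 w := 'D_w (fun y => 'D_w phi y) x0.
have key w : - (rate C t * dot (w *m G) (w *m G)) <= D2 w.
  set Y := dot (w *m G) (w *m G); have Y0 : 0 <= Y := dotvv_ge0 _.
  have kernel kap : 1 < kap -> exists N, forall e,
      t * (L (grad H p + t^-1 *: e) - L (grad H p)) <= ptest p G (kap / 2 / t) N e.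
    move=> kap1; have [N hN] := legendre_sharp_upper HC2 th0 Hth kap1 BT BB Bu.
    by exists (N / t ^+ 3) => e; exact: legendre_kernel_upper.
  have ptest0 A N : ptest p G A N 0 = 0 by rewrite /ptest mul0mx !dot0r; ring.
  have psi_smooth c a b z A N : smooth
      (fun y => phi (c + a *: y) + ptest p G A N (b *: (y - z))).
    move=> k; apply: Ck_add; first exact: Ck_affine.
    rewrite (_ : (fun y => _) = fun y => ptest p G A N (- (b *: z) + b *: y)).
      by apply: (@Ck_affine _ _ (ptest _ _ _ _)); exact: ptest_Ck.
    by apply/funext => y; rewrite scalerBr addrC.
  case: C C0 init {rate_ge0} => [c| |] //=.
    rewrite lte_fin => c0 init; pose a := 1 + c * t; pose b := - (c * t).
    have a0 : 0 < a by rewrite addr_gt0 ?mulr_gt0.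
    suff : - (c ^+ 2 * t * Y) <= a ^+ 2 * D2 w + c * Y.
      move=> h; have : - (c * a * Y) <= a ^+ 2 * D2 w by rewrite /a in h *; lra.
      move=> {}h; rewrite -(ler_pM2l (exprn_gt0 2 a0)) -/a.
      have -> // : a ^+ 2 * - (c / a * Y) = - (c * a * Y).
      by clearbody a; field; rewrite gt_eqF.
    apply: ge_opp_mul_gt1 => [|kap kap1].
      exact: (mulr_ge0 (mulr_ge0 (sqr_ge0 c) (ltW t0)) Y0).
    have [N hN] := kernel kap kap1.
    set psi := fun y =>
      phi ((x0 - a *: y0) + a *: y) + ptest p G (kap / 2 / t) N (b *: (y - y0)).
    have [] := derive_test (x0 - a *: y0) y0 a b p G (kap / 2 / t) N w phiC.
    rewrite subrK => _; rewrite -/psi => D2psi.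
    have grad_psi : grad psi y0 = p.
      apply/rowP => i; rewrite mxE.
      have [-> _] := derive_test (x0 - a *: y0) y0 a b p G (kap / 2 / t) N (delta_mx 0 i) phiC.
      rewrite subrK derive_grad ?gp; last exact: Ck2_diff.
      rewrite [dot p _]dotC -mulrDl (_ : a + b = 1) ?mul1r; last by rewrite /a /b; ring.
      rewrite dotE (bigD1 i) //= big1 => [|j /negPf ji].
        by rewrite mxE !eqxx mul1r addr0.
      by rewrite mxE ji andbF mul0r.
    have psi_max y : u (y, 0) - psi y <= u (y0, 0) - psi y0.
      rewrite /psi subrr scaler0 ptest0 subrK addr0.
      have := hphi (x0 - a *: y0 + a *: y) y; have := hN (b *: (y - y0)).
      have -> : t^-1 *: (y - (x0 - a *: y0 + a *: y)) =
          grad H p + t^-1 *: (b *: (y - y0)).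
        have -> : grad H p = t^-1 *: (y0 - x0).
          by rewrite e0 scalerA mulVf ?gt_eqF // scale1r.
        rewrite -scalerDr; congr (_ *: _).
        by apply/rowP => i; rewrite !mxE /a /b; ring.
      move: (t * _) (ptest _ _ _ _ _) => X P hXP hX; clear -hXP hX; lra.
    have := init c erefl psi y0 (psi_smooth _ _ _ _ _ _) psi_max (w *m G).
    rewrite grad_psi /sqrtmx -sB mxle_scalar_dot -/Y.
    have -> : (w *m G *m - (B *m hess psi y0 *m B) *m (w *m G)^T) 0 0 =
        - 'D_w (fun y => 'D_w psi y) y0.
      rewrite derive2_hess; last exact: psi_smooth.
      have GT : G^T = G by rewrite /G trmx_inv BT.
      by rewrite mulmxN mulNmx mxE trmx_mul GT !mulmxA mulmxKV // mulmxK.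
    rewrite D2psi -/(D2 w) -/Y /b.
    have -> : (- (c * t)) ^+ 2 * (2 * (kap / 2 / t) * Y) = kap * (c ^+ 2 * t * Y).
      by field; rewrite gt_eqF.
    move: (kap * _) (D2 w) => q d2 hq; clear -hq; lra.
  move=> _ _; apply: ge_opp_mul_gt1 => [|kap kap1].
    by rewrite mulr_ge0 // invr_ge0 ltW.
  have [N hN] := kernel kap kap1.
  have [] := @min_derive _ _ _ x0 w (psi_smooth 0 1 (-1) x0 (kap / 2 / t) N 2%N) _.
    move=> x; rewrite !add0r !scale1r subrr scaler0 ptest0.
    have := phi_ge x; have := hN ((-1) *: (x - x0)).
    have -> : t^-1 *: (y0 - x) = grad H p + t^-1 *: ((-1) *: (x - x0)).
      rewrite scaleN1r opprB -[y0](subrK x0) -addrA e0 scalerDr scalerA mulVf ?gt_eqF //.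
      by rewrite scale1r.
    move: (t * _) (ptest _ _ _ _ _) => X P hXP hX; lra.
  have [_ ->] := derive_test 0 x0 1 (-1) p G (kap / 2 / t) N w phiC.
  rewrite add0r scale1r -/(D2 w) -/Y => _.
  have -> : kap * (t^-1 * Y) = 2 * (kap / 2 / t) * Y by field; rewrite gt_eqF.
  by rewrite sqrrN !expr1n !mul1r; lra.
move=> v; rewrite mxle_scalar_dot.
have := key (v *m B); rewrite /D2 derive2_hess // mulmxK //.
rewrite mulmxN mulNmx mxE /dot trmx_mul BT !mulmxA; lra.
Qed.

End Curvature.

(** * Reflection, and the theorem *)
Lemma derive_opp_arg (R : realType) (V : normedModType R) (f : V -> R) x v :
  differentiable f (- x) -> is_derive x v (fun y => f (- y)) (- 'D_v f (- x)).
Proof.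
move=> df; have := @derive_affine R V f 0 (-1) x v.
rewrite add0r scaleN1r mulN1r; move=> /(_ df).
by congr (is_derive _ _ _ _); apply/funext => y; rewrite add0r scaleN1r.
Qed.

Lemma hess_opp_arg (R : realType) (d : nat) (f : 'rV[R]_d -> R) p :
  Ck setT 2 f -> hess (fun q => f (- q)) p = hess f (- p).
Proof.
move=> hf; apply/matrixP => i j; rewrite [LHS]mxE [RHS]mxE.
have -> : (fun y => 'D_(delta_mx 0 j) (fun q => f (- q)) y) =
    fun y => - 'D_(delta_mx 0 j) f (- y).
  apply/funext => y; apply: (@derive_val _ _ _ _ _ _ _ _).
  by apply: derive_opp_arg; exact: Ck2_diff.
apply: (@derive_val _ _ _ _ _ _ _ _).
rewrite -[X in is_derive _ _ _ X]opprK; apply: is_deriveN.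
by apply: (@derive_opp_arg _ _ (fun y => 'D_(delta_mx 0 j) f y)); exact: Ck2_diff1.
Qed.

Lemma Ck_opp_arg (R : realType) (V : normedModType R) (f : V -> R) k :
  Ck setT k f -> Ck setT k (fun q => f (- q)).
Proof.
move=> /(@Ck_affine _ _ _ 0 (-1)).
by congr Ck; apply/funext => x; rewrite add0r scaleN1r.
Qed.

Section OppositeTest.
Context {R : realType} {d : nat}.
Implicit Types (phi : 'rV[R]_d -> R).

Lemma Ck_opp phi k : Ck setT k phi -> Ck setT k (fun x => - phi x).
Proof.
move=> hphi; rewrite (_ : (fun x => _) = fun x => -1 * phi x).
  by apply: Ck_mul => //; exact: Ck_cst.
by apply/funext => x; rewrite mulN1r.
Qed.

Lemma grad_opp phi x : Ck setT 2 phi -> grad (fun y => - phi y) x = - grad phi x.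
Proof.
move=> hphi; apply/rowP => i; rewrite !mxE deriveN //.
by apply: diff_derivable; exact: Ck2_diff.
Qed.

Lemma hess_opp phi x : Ck setT 2 phi -> hess (fun y => - phi y) x = - hess phi x.
Proof.
move=> hphi; apply/matrixP => i j; rewrite !mxE.
have -> : (fun y => 'D_(delta_mx 0 j) (fun z => - phi z) y) =
    - (fun y => 'D_(delta_mx 0 j) phi y).
  by apply/funext => y; rewrite deriveN //; apply: diff_derivable; exact: Ck2_diff.
by rewrite deriveN //; apply: diff_derivable; exact: Ck2_diff1.
Qed.

Lemma mxle_scalarN (A : 'M[R]_d) (c : R) :
  mxle (- c%:M) A <-> mxle (- A) c%:M.
Proof.
split=> h v; have := h v; rewrite !mulmxN !mulNmx !mxE; lra.
Qed.

Lemma visc_ge_opp (F : 'rV[R]_d -> 'M[R]_d) v (K : R) :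
  visc_ge F v (- K) <-> visc_le (fun p => F (- p)) (fun x => - v x) K.
Proof.
split=> h phi x0 phis hext; have phiC := phis 2%N.
  have := h (fun x => - phi x) x0 (fun k => Ck_opp (phis k)).
  move=> /(_ _)/wrap[x|]; first by have := hext x; lra.
  rewrite grad_opp // hess_opp // mulmxN mulNmx opprK raddfN /=.
  by move=> /mxle_scalarN.
have := h (fun x => - phi x) x0 (fun k => Ck_opp (phis k)).
move=> /(_ _)/wrap[x|]; first by have := hext x; lra.
rewrite grad_opp // hess_opp // !opprK mulmxN mulNmx opprK raddfN /= => h1.
by apply/mxle_scalarN; rewrite opprK.
Qed.

End OppositeTest.
Unset Implicit Arguments.
Set Strict Implicit.

Theorem theorem1p1 (R : realType) (d : nat) (H : 'rV[R]_d -> R) (C : \bar R)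
    (HC2 : Ck setT 2 H) (Hconv : uniformly_convex H) (C_gt0 : (0 < C)%E) :
  let F := fun p => sqrtmx (hess H p) in
  (forall u : 'rV[R]_d * R -> R,
     BUC [set z : 'rV[R]_d * R | 0 <= z.2] u ->
     viscosity_solution H u ->
     (forall c : R, C = c%:E -> visc_le F (fun x => u (x, 0)) c) ->
     forall t : R, 0 < t -> visc_le F (fun x => u (x, t)) (rate C t)) /\
  (forall u : 'rV[R]_d * R -> R,
     BUC [set z : 'rV[R]_d * R | 0 <= z.2] u ->
     viscosity_solution (fun p => - H p) u ->
     (forall c : R, C = c%:E -> visc_ge F (fun x => u (x, 0)) (- c)) ->
     forall t : R, 0 < t -> visc_ge F (fun x => u (x, t)) (- rate C t)).
Proof.
move=> F; have [Th [th [Th0 th0 Hq]]] := Hconv.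
have Hth p : mxle th%:M (hess H p) := (Hq p).1.
have HTh p : mxle (hess H p) Th%:M := (Hq p).2.
split=> u hu vu init t t0.
  apply: (curvature_bound HC2 th0 Th0 Hth HTh C_gt0 hu _ t0 init).
  by move=> p b a A N x s s0; exact: visc_qtest.
have hessE p : hess (fun q => H (- q)) p = hess H (- p) := hess_opp_arg p HC2.
have FE : (fun p => sqrtmx (hess (fun q => H (- q)) p)) = fun p => F (- p).
  by apply/funext => p; rewrite hessE.
apply/visc_ge_opp; rewrite -FE.
apply: (@curvature_bound R d (fun q => H (- q)) th Th (Ck_opp_arg HC2) th0 Th0 _ _
  (fun z => - u z) t C C_gt0 (BUC_opp hu) _ t0).
- by move=> p; rewrite hessE.
- by move=> p; rewrite hessE.
- apply: quad_solution_opp => p b a A N x s s0.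
  exact: (visc_qtest p b a A N x vu s0).
- by move=> c Cc; rewrite FE; apply/visc_ge_opp; exact: init.
Qed.
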